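(* Let $\beta>0$. (i) If $f\in L^p(\mathbb{R})$ for some $1<p\le2$, then $\widehat{\mathcal{C}_\beta f}=\mathcal{C}_\beta^*\hat f$ (almost everywhere). (ii) If $f\in L^p(\mathbb{R})$ for some $1\le p\le2$, then $\widehat{\mathcal{C}_\beta^*f}=\mathcal{C}_\beta\hat f$ (almost everywhere).
   Context: The Fourier transform of $f\in L^1(\mathbb{R})$ is $\hat f(t)=\int_{-\infty}^\infty e^{-ixt}f(x)\,dx$; for $f\in L^p(\mathbb{R})$ with $1<p\le2$, $\hat f\in L^{p'}(\mathbb{R})$ ($\frac1p+\frac1{p'}=1$) is the $L^{p'}$-limit of $\int_{-R}^Re^{-ixt}f(x)\,dx$ as $R\to\infty$. The generalized Cesàro operator on $\mathbb{R}$ is $\mathcal{C}_\beta f(t)=\frac{\beta}{|t|^\beta}\int_t^0(s-t)^{\beta-1}f(s)\,ds$ for $t<0$, $\mathcal{C}_\beta f(t)=\frac{\beta}{t^\beta}\int_0^t(t-s)^{\beta-1}f(s)\,ds$ for $t>0$ (and $\mathcal{C}_\beta f(0)=f(0)$), i.e. $\mathcal{C}_\beta f(t)=\beta\int_0^1(1-r)^{\beta-1}f(tr)\,dr$. The generalized dual Cesàro operator is $\mathcal{C}_\beta^*f(t)=\beta\int_{-\infty}^t\frac{(t-s)^{\beta-1}}{|s|^\beta}f(s)\,ds$ for $t<0$, $\mathcal{C}_\beta^*f(t)=\beta\int_t^\infty\frac{(s-t)^{\beta-1}}{s^\beta}f(s)\,ds$ for $t>0$ (and $\mathcal{C}_\beta^*f(0)=0$).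 *)

(* Defs.v *)
From HB Require Import structures.
From mathcomp Require Import all_boot all_order all_algebra.
From mathcomp Require Import all_classical all_reals all_analysis.
From mathcomp Require Import complex.
Set Implicit Arguments. Unset Strict Implicit. Unset Printing Implicit Defensive.
Import Order.TTheory GRing.Theory Num.Theory.
Local Open Scope classical_set_scope.
Local Open Scope ring_scope.
Local Open Scope complex_scope.

Section FourierCesaro.
Variable R : realType.
Local Notation mu := (@lebesgue_measure R).

Definition cnorm (z : R[i]) : R := Num.sqrt (complex.Re z ^+ 2 + complex.Im z ^+ 2).

Definition expi (th : R) : R[i] := Complex (cos th) (sin th).

Definition cintegral (D : set R) (f : R -> R[i]) : R[i] :=
  Complex (Rintegral mu D (fun x => complex.Re (f x)))
          (Rintegral mu D (fun x => complex.Im (f x))).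

Definition cmeasurable (f : R -> R[i]) : Prop :=
  measurable_fun setT (fun x => complex.Re (f x)) /\
  measurable_fun setT (fun x => complex.Im (f x)).

Definition in_Lp (p : R) (f : R -> R[i]) : Prop :=
  cmeasurable f /\ (Lnorm mu p%:E (fun x => (cnorm (f x))%:E) < +oo)%E.

Definition conj_exp (p : R) : R := p / (p - 1).

Definition fourier_trunc (f : R -> R[i]) (r t : R) : R[i] :=
  cintegral [set x | - r <= x <= r] (fun x => expi (- (x * t)) * f x).

Definition fourier_L1 (f : R -> R[i]) (t : R) : R[i] :=
  cintegral setT (fun x => expi (- (x * t)) * f x).

(* is_fourier p f g : f \in L^p(R) (1 <= p <= 2) and g is (a representative of)
   its Fourier transform: for p = 1, g t = int e^{-ixt} f(x) dx for every t;
   for 1 < p <= 2, g \in L^{p'} and g is the L^{p'}-limit as r -> oo of the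
   truncated integrals int_{-r}^{r} e^{-ixt} f(x) dx. *)
Definition is_fourier (p : R) (f g : R -> R[i]) : Prop :=
  in_Lp p f /\
  if p == 1 then (forall t, g t = fourier_L1 f t)
  else in_Lp (conj_exp p) g /\
       (fun r => Lnorm mu (conj_exp p)%:E
                   (fun t => (cnorm (fourier_trunc f r t - g t))%:E))
         @ +oo --> 0%E.

Definition Ces (beta : R) (f : R -> R[i]) (t : R) : R[i] :=
  (beta%:C * cintegral [set r | 0 <= r <= 1]
      (fun r => ((1 - r) `^ (beta - 1))%:C * f (t * r)))%R.

Definition Cesdual (beta : R) (f : R -> R[i]) (t : R) : R[i] :=
  if t < 0 then
    (beta%:C * cintegral [set s | s <= t]
        (fun s => ((t - s) `^ (beta - 1) / (`|s| `^ beta))%:C * f s))%R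
  else if 0 < t then
    (beta%:C * cintegral [set s | t <= s]
        (fun s => ((s - t) `^ (beta - 1) / (s `^ beta))%:C * f s))%R
  else 0.

End FourierCesaro.

(* Main.v *)
Require Import Defs.
From mathcomp Require Import all_boot all_order all_algebra.
From mathcomp Require Import all_classical all_reals all_analysis.
From mathcomp Require Import complex.
From mathcomp Require Import measurable_realfun ring lra.
Import Order.TTheory GRing.Theory Num.Theory.
Import numFieldNormedType.Exports.
Local Open Scope classical_set_scope.
Local Open Scope ring_scope.
Local Open Scope complex_scope.
Set Implicit Arguments. Unset Strict Implicit. Unset Printing Implicit Defensive.

(* Cesàro operators are averages of dilations: for a weight V >= 0 and dilations th, put
     H f (x) = int V(u) f(x th(u)) du    and    H' g (t) = int (V/th)(u) g(t / th(u)) du.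
   C_beta is H for th(u) = u and V(u) = beta (1 - u)^(beta - 1) on ]0, 1[, its dual is the
   corresponding H', and passing from H to H' is an involution. By Fubini, the truncated
   transforms F_r satisfy
     F_r (H f) (t) = int (V/th)(u) (F_{r th(u)} f)(t / th(u)) du,
   so if th >= c on the support of V, Minkowski's integral inequality bounds the L^p' norm of
   F_r (H f) - H' g by int V th^(-1/p) times the supremum of |F_r' f - g|_p' over r' >= r c.
   Since th(u) = 1/u >= 1 for the dual operator, this proves (ii).
   In (i) th(u) = u is not bounded below, so the dilations u <= kap are cut off. The kernel against
   which their truncated transform integrates f(y) is the integral of
   e^(-iyt/u) beta (1 - u)^(beta - 1) / u over |y|/r <= u <= kap. Integration by parts for large
   |yt|/kap and the absolute value of the integrand for small |yt|/kap bound it by C e(yt/kap),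
   where e(z) is |z|^(-d) near 0 and 1/|z| near infinity. As f |-> int |f(y)| e(yt) dy maps L^p
   to L^p' for p <= 2, the L^p' norm of this part is O(kap^(1/p')), uniformly in r. *)

(** * Complex modulus and measurability *)

Section complex_modulus.
Variable R : realType.
Implicit Types z w : R[i].

Lemma cnorm_normc z : (cnorm z)%:C = `|z|.
Proof. by case: z => a b; rewrite /cnorm normc_def. Qed.

Lemma cnorm_ge0 z : 0 <= cnorm z. Proof. exact: sqrtr_ge0. Qed.

Lemma cnormM z w : cnorm (z * w) = cnorm z * cnorm w.
Proof. by apply: complexI; rewrite rmorphM/= !cnorm_normc normrM. Qed.

Lemma cnormD z w : cnorm (z + w) <= cnorm z + cnorm w.
Proof. by rewrite -lecR rmorphD/= !cnorm_normc ler_normD. Qed.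

Lemma cnormN z : cnorm (- z) = cnorm z.
Proof. by apply: complexI; rewrite !cnorm_normc normrN. Qed.

Lemma cnorm_real (a : R) : cnorm a%:C = `|a|.
Proof. by rewrite /cnorm/= expr0n/= addr0 sqrtr_sqr. Qed.

Lemma cnorm_ge0_realM (a : R) z : 0 <= a -> cnorm (a%:C * z) = a * cnorm z.
Proof. by move=> a0; rewrite cnormM cnorm_real ger0_norm. Qed.

Lemma cnorm_expi (t : R) : cnorm (expi t) = 1.
Proof. by rewrite /cnorm/expi/= cos2Dsin2 sqrtr1. Qed.

Lemma Re_le_cnorm z : `|complex.Re z| <= cnorm z.
Proof. by rewrite /cnorm -sqrtr_sqr ler_wsqrtr// lerDl sqr_ge0. Qed.

Lemma Im_le_cnorm z : `|complex.Im z| <= cnorm z.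
Proof. by rewrite /cnorm -sqrtr_sqr ler_wsqrtr// lerDr sqr_ge0. Qed.

Lemma cnorm_le_ReIm z : cnorm z <= `|complex.Re z| + `|complex.Im z|.
Proof.
rewrite /cnorm -[leRHS]ger0_norm ?addr_ge0// -sqrtr_sqr ler_wsqrtr//.
by rewrite sqrrD !real_normK ?num_real// -addrA lerD2l lerDr mulrn_wge0// mulr_ge0.
Qed.

Lemma complex_realM (a : R) z : a%:C * z = (a * complex.Re z) +i* (a * complex.Im z).
Proof. by case: z => x y; congr Complex => /=; rewrite mul0r ?subr0 ?addr0. Qed.

Lemma ReB z w : complex.Re (z - w) = complex.Re z - complex.Re w.
Proof. by case: z w => a b [c e]. Qed.

Lemma ImB z w : complex.Im (z - w) = complex.Im z - complex.Im w.
Proof. by case: z w => a b [c e]. Qed.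

Lemma ReD z w : complex.Re (z + w) = complex.Re z + complex.Re w.
Proof. by case: z w => a b [c e]. Qed.

Lemma ImD z w : complex.Im (z + w) = complex.Im z + complex.Im w.
Proof. by case: z w => a b [c e]. Qed.

End complex_modulus.

#[local] Hint Extern 0 (is_true (_ <= powR _ _)%R) => exact: powR_ge0 : core.
#[local] Hint Extern 0 (is_true (_ <= poweR _ _)%E) => exact: poweR_ge0 : core.
#[local] Hint Extern 0 (is_true (_ <= Lnorm _ _ _)%E) => exact: Lnorm_ge0 : core.
#[local] Hint Extern 0 (is_true (_ <= cnorm _)%R) => exact: cnorm_ge0 : core.

Section parametric_integrals.
Context d1 d2 (T1 : measurableType d1) (T2 : measurableType d2) (R : realType).
Variable m : {sigma_finite_measure set T2 -> \bar R}.

Lemma measurable_ge0_integral_param (F : T1 -> T2 -> \bar R) :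
  measurable_fun setT (fun z => F z.1 z.2) -> (forall x y, 0 <= F x y)%E ->
  measurable_fun setT (fun x => \int[m]_y F x y)%E.
Proof.
move=> mF F0; exact: (measurable_fun_fubini_tonelli_F _ mF (fun z => F0 z.1 z.2)).
Qed.

Lemma measurable_Rintegral_param (F : T1 -> T2 -> R) :
  measurable_fun setT (fun z => F z.1 z.2) ->
  measurable_fun setT (fun x => Rintegral m setT (fun y => F x y)).
Proof.
move=> mF; rewrite /Rintegral; apply: (measurableT_comp (fine_measurable measurableT)) => //.
have mE : measurable_fun setT (fun z => (F z.1 z.2)%:E) by exact/measurable_EFinP.
under eq_fun do rewrite integralE; apply: emeasurable_funB.
- apply: (@measurable_ge0_integral_param (fun x => (EFin \o F x)^\+%E)) => //.
  by apply: eq_measurable_fun (measurable_funepos mE) => z _; rewrite !funeposE.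
- apply: (@measurable_ge0_integral_param (fun x => (EFin \o F x)^\-%E)) => //.
  by apply: eq_measurable_fun (measurable_funeneg mE) => z _; rewrite !funenegE.
Qed.

End parametric_integrals.

Section complex_measurability.
Variable R : realType.

(* The inverse is not continuous at 0, but x^-1 = x * (x^2)^(-1). *)
Lemma measurable_invr : measurable_fun setT (fun x : R => x^-1).
Proof.
rewrite (_ : (fun x => _) = (fun x => x * (x ^+ 2) `^ (-1))); last first.
  apply/funext => x; rewrite powR_inv1 ?sqr_ge0//.
  have [->|x0] := eqVneq x 0; first by rewrite invr0 mul0r.
  by rewrite expr2 invfM mulrA divff// mul1r.
apply: measurable_funM => //.
apply: (measurableT_comp (measurable_powR (-1))).
exact: measurable_funX.
Qed.

Definition cmeasurable_fun d (T : measurableType d) (F : T -> R[i]) : Prop :=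
  measurable_fun setT (fun x => complex.Re (F x)) /\
  measurable_fun setT (fun x => complex.Im (F x)).

Context d (T : measurableType d).
Implicit Types F G : T -> R[i].

Lemma cmeasurable_funM F G : cmeasurable_fun F -> cmeasurable_fun G ->
  cmeasurable_fun (fun x => F x * G x).
Proof.
move=> [mF1 mF2] [mG1 mG2].
have FGE x : F x * G x =
    (complex.Re (F x) * complex.Re (G x) - complex.Im (F x) * complex.Im (G x)) +i*
    (complex.Re (F x) * complex.Im (G x) + complex.Im (F x) * complex.Re (G x)).
  by case: (F x) (G x) => a b [c e].
split; under eq_fun do rewrite FGE/=.
- by apply: measurable_funB; apply: measurable_funM.
- by apply: measurable_funD; apply: measurable_funM.
Qed.

Lemma cmeasurable_funB F G : cmeasurable_fun F -> cmeasurable_fun G ->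
  cmeasurable_fun (fun x => F x - G x).
Proof.
move=> [mF1 mF2] [mG1 mG2].
by split; under eq_fun do rewrite ?ReB ?ImB; apply: measurable_funB.
Qed.

Lemma cmeasurable_funD F G : cmeasurable_fun F -> cmeasurable_fun G ->
  cmeasurable_fun (fun x => F x + G x).
Proof.
move=> [mF1 mF2] [mG1 mG2].
by split; under eq_fun do rewrite ?ReD ?ImD; apply: measurable_funD.
Qed.

Lemma cmeasurable_fun_real (F : T -> R) :
  measurable_fun setT F -> cmeasurable_fun (fun x => (F x)%:C).
Proof. by move=> mF; split => /=. Qed.

Lemma cmeasurable_fun_expi (F : T -> R) :
  measurable_fun setT F -> cmeasurable_fun (fun x => expi (F x)).
Proof.
move=> mF; split => /=; apply: (measurableT_comp _ mF); apply: continuous_measurable_fun.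
- exact: continuous_cos.
- exact: continuous_sin.
Qed.

Lemma measurable_cnorm F : cmeasurable_fun F -> measurable_fun setT (fun x => cnorm (F x)).
Proof.
move=> [mRe mIm]; rewrite /cnorm.
apply: (measurableT_comp (continuous_measurable_fun (@sqrt_continuous R))).
by apply: measurable_funD; exact: measurable_funX.
Qed.

Lemma cmeasurable_fun_comp d' (T' : measurableType d') (h : T' -> T) F :
  measurable_fun setT h -> cmeasurable_fun F -> cmeasurable_fun (fun x => F (h x)).
Proof.
by move=> mh [mRe mIm]; split; [exact: (measurableT_comp mRe)|exact: (measurableT_comp mIm)].
Qed.

Lemma cmeasurable_fun_comp2 d1 d2 (T1 : measurableType d1) (T2 : measurableType d2)
    (D : T1 -> T2 -> R[i]) (a : T -> T1) (b : T -> T2) :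
  cmeasurable_fun (fun z : T1 * T2 => D z.1 z.2) ->
  measurable_fun setT a -> measurable_fun setT b -> cmeasurable_fun (fun x => D (a x) (b x)).
Proof.
move=> [mRe mIm] ma mb; have mab := measurable_fun_pair ma mb.
by split; [exact: (measurableT_comp mRe mab)|exact: (measurableT_comp mIm mab)].
Qed.

Lemma cmeasurable_cintegral (F : T -> R -> R[i]) : cmeasurable_fun (fun z => F z.1 z.2) ->
  cmeasurable_fun (fun x => cintegral setT (fun y => F x y)).
Proof.
move=> [mRe mIm]; split => /=.
- exact: (@measurable_Rintegral_param _ _ T (measurableTypeR R) R lebesgue_measure
    (fun x y => complex.Re (F x y)) mRe).
- exact: (@measurable_Rintegral_param _ _ T (measurableTypeR R) R lebesgue_measure
    (fun x y => complex.Im (F x y)) mIm).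
Qed.

End complex_measurability.

Ltac positivity :=
  lazymatch goal with
  | |- is_true (_ <= EFin _)%E => rewrite lee_fin; positivity
  | |- is_true (_ <= _ * _)%E => apply: mule_ge0; positivity
  | |- is_true (_ <= poweR _ _)%E => apply: poweR_ge0
  | |- is_true (_ <= Lnorm _ _ _)%E => apply: Lnorm_ge0
  | |- is_true (_ <= integral _ _ _)%E => apply: integral_ge0 => ? _; positivity
  | |- is_true (_ <= _ * _)%R => apply: mulr_ge0; positivity
  | |- is_true (_ <= _ + _)%R => first [apply: addr_ge0 | apply: adde_ge0]; positivity
  | |- is_true (_ <= _ ^-1)%R => rewrite invr_ge0; positivity
  | |- is_true (_ <= powR _ _)%R => apply: powR_ge0
  | |- is_true (_ <= cnorm _)%R => apply: cnorm_ge0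
  | |- is_true (_ <= @Num.norm _ _ _)%R => apply: normr_ge0
  | |- is_true (_ <= if _ then _ else _)%R => case: ifPn => _; positivity
  | _ =>
    match goal with
    | |- _ => assumption
    | H : is_true _ |- _ => exact: (ltW H)
    | H : forall _, is_true _ |- _ => exact: H
    | H : forall _, is_true _ |- _ => exact: (ltW (H _))
    | |- _ => by []
    end
  end.

Ltac measurability :=
  lazymatch goal with
  | |- measurable_fun _ (EFin \o _) => apply/measurable_EFinP; measurability
  | |- measurable_fun _ (fun x => EFin _) => apply/measurable_EFinP; measurability
  | |- measurable_fun _ (fun x => (_ * _)%R) => apply: measurable_funM; measurability
  | |- measurable_fun _ (fun x => (_ - _)%R) => apply: measurable_funB; measurability
  | |- measurable_fun _ (fun x => (_ + _)%R) =>
      first [apply: measurable_funD | apply: emeasurable_funD]; measurability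
  | |- measurable_fun _ (fun x => (- _)%R) => apply: measurable_funN; measurability
  | |- measurable_fun _ (fun x => (_ * _)%E) => apply: emeasurable_funM; measurability
  | |- measurable_fun _ (fun x => if _ then _ else _) =>
      apply: measurable_fun_ifT; measurability
  | |- measurable_fun _ (fun x => _ && _) => apply: measurable_and; measurability
  | |- measurable_fun _ (fun x => _ == _) => apply: measurable_fun_eqr; measurability
  | |- measurable_fun _ (fun x => _ <= _) => apply: measurable_fun_ler; measurability
  | |- measurable_fun _ (fun x => _ < _) => apply: measurable_fun_ltr; measurability
  | |- measurable_fun _ (fun x => powR _ _) =>
      apply: (measurableT_comp (measurable_powR _)); measurability
  | |- measurable_fun _ (fun x => poweR _ _) =>
      apply: (measurableT_comp (measurable_poweR _)); measurability
  | |- measurable_fun _ (fun x => @Num.norm _ _ _) =>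
      apply: (measurableT_comp (@normr_measurable _ setT)); measurability
  | |- measurable_fun _ (fun x => abse _) =>
      apply: (measurableT_comp (@abse_measurable _ setT)); measurability
  | |- measurable_fun _ (fun x => (_ ^-1)%R) =>
      apply: (measurableT_comp (@measurable_invr _)); measurability
  | |- measurable_fun _ (fun x => cnorm _) => apply: measurable_cnorm; measurability
  | |- measurable_fun _ (fun x => fst _) =>
      apply: (measurableT_comp measurable_fst); measurability
  | |- measurable_fun _ (fun x => snd _) =>
      apply: (measurableT_comp measurable_snd); measurability
  | |- measurable_fun _ (fun x => (_, _)) => apply: measurable_fun_pair; measurability
  | |- measurable_fun _ (fun x => integral _ _ _) =>
      apply: measurable_ge0_integral_param => [|? ?]; [measurability|positivity]
  | |- cmeasurable_fun (fun x => cintegral setT _) =>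
      apply: cmeasurable_cintegral; measurability
  | |- cmeasurable_fun (fun x => (_ * _)%R) => apply: cmeasurable_funM; measurability
  | |- cmeasurable_fun (fun x => (_ - _)%R) => apply: cmeasurable_funB; measurability
  | |- cmeasurable_fun (fun x => (_ + _)%R) => apply: cmeasurable_funD; measurability
  | |- cmeasurable_fun (fun x => _%:C) => apply: cmeasurable_fun_real; measurability
  | |- cmeasurable_fun (fun x => expi _) => apply: cmeasurable_fun_expi; measurability
  | _ =>
    match goal with
    | |- _ => assumption
    | |- measurable_fun _ (@Num.norm _ _) => exact: normr_measurable
    | |- measurable_fun _ (@GRing.inv _) => exact: measurable_invr
    | |- measurable_fun _ \1__ => exact: measurable_indic
    | |- measurable_fun _ (fun x => \1__ _) => exact: measurable_indic
    | |- measurable_fun _ (pair _) => exact: pair1_measurable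
    | |- measurable_fun _ fst => exact: measurable_fst
    | |- measurable_fun _ snd => exact: measurable_snd
    | |- measurable_fun _ (fun x => x) => exact: measurable_id
    | |- measurable_fun _ (fun x => _) => exact: measurable_cst
    | H : measurable_fun _ ?h |- measurable_fun _ (fun x => ?h _) =>
        apply: (measurableT_comp H); measurability
    | H : forall _, measurable_fun _ _ |- measurable_fun _ _ => exact: H
    | H : forall _, measurable_fun _ _ |- measurable_fun _ (fun x => _ _) =>
        apply: (measurableT_comp (H _)); measurability
    | H : forall _, cmeasurable_fun _ |- cmeasurable_fun _ => exact: H
    | H : cmeasurable_fun ?h |- cmeasurable_fun (fun x => ?h _) =>
        apply: (cmeasurable_fun_comp _ H); measurability
    | H : cmeasurable_fun (fun z => ?h (fst z) (snd z)) |- cmeasurable_fun (fun x => ?h _ _) =>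
        apply: (cmeasurable_fun_comp2 H); measurability
    | |- cmeasurable_fun (?g ?a) => change (cmeasurable_fun (fun x => g a x)); measurability
    | |- measurable_fun ?D (?g ?a) => change (measurable_fun D (fun x => g a x)); measurability
    | g := _ |- measurable_fun _ ?g => unfold g; measurability
    | g := _ |- measurable_fun _ (fun x => ?g _) => unfold g; measurability
    | g := _ |- cmeasurable_fun ?g => unfold g; measurability
    | g := _ |- cmeasurable_fun (fun x => ?g _) => unfold g; measurability
    end
  end.

#[local] Hint Extern 0 (measurable_fun _ _) => solve [measurability] : core.
#[local] Hint Extern 0 (cmeasurable_fun _) => solve [measurability] : core.
#[local] Hint Extern 0 (is_true (_ <= EFin _)%E) => solve [positivity] : core.
#[local] Hint Extern 0 (is_true (_ <= _ * _)%E) => solve [positivity] : core.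
#[local] Hint Extern 0 (is_true (_ <= integral _ _ _)%E) => solve [positivity] : core.

(** * Change of variables *)

Section affine_change_of_variables.
Variable R : realType.
Local Notation mu := (@lebesgue_measure R).

Lemma lebesgue_measure_affine_preimage (a e : R) (X : set R) : a != 0 -> ocitv X ->
  (mu ((fun x => (x * a + e)%R) @^-1` X) = (`|a|^-1)%:E * mu X)%E.
Proof.
move=> a0 [[c d]] _ <-.
have [an|ap|/eqP] := ltgtP a 0; last by rewrite (negbTE a0).
- have -> : (fun x => x * a + e) @^-1` [set` `]c, d]] = `[(d - e) / a, (c - e) / a[%classic.
    apply/seteqP; split => x /=;
      by rewrite !in_itv/= ler_ndivrMr// ltr_ndivlMr// ltrBlDr lerBrDr => /andP[-> ->].
  rewrite !lebesgue_measure_itv/= !lte_fin ltr_nM2r ?invr_lt0// ltrD2r.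
  case: ifPn => _; last by rewrite mule0.
  rewrite -EFinD -EFinM -mulrBl ltr0_norm// invrN mulNr -mulrN opprB mulrC.
  by congr (_ * _)%:E; ring.
- have -> : (fun x => x * a + e) @^-1` [set` `]c, d]] = `](c - e) / a, (d - e) / a]%classic.
    apply/seteqP; split => x /=;
      by rewrite !in_itv/= ltr_pdivrMr// ler_pdivlMr// ltrBlDr lerBrDr => /andP[-> ->].
  rewrite !lebesgue_measure_itv/= !lte_fin ltr_pM2r ?invr_gt0// ltrD2r.
  case: ifPn => _; last by rewrite mule0.
  rewrite -EFinD -EFinM -mulrBl gtr0_norm// mulrC.
  by congr (_ * _)%:E; ring.
Qed.

Lemma ge0_integral_affine (a e : R) (f : R -> \bar R) : a != 0 ->
  measurable_fun setT f -> (forall x, 0 <= f x)%E ->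
  (\int[mu]_x f (x * a + e)%R = (`|a|^-1)%:E * \int[mu]_x f x)%E.
Proof.
move=> a0 mf f0.
pose phi := fun x : measurableTypeR R => (x * a + e : measurableTypeR R).
have mphi : measurable_fun setT phi by apply: measurable_funD => //; apply: measurable_funM.
have na0 : 0 <= `|a| by [].
have nai0 : 0 <= `|a|^-1 by rewrite invr_ge0.
have pushE A : measurable A -> pushforward mu phi A = mscale (NngNum nai0) mu A.
  move=> mA; rewrite /mscale/=.
  rewrite (@lebesgue_measure_unique R (mscale (NngNum na0) (pushforward mu phi)) _ A mA)//.
    by rewrite /mscale/= muleA -EFinM mulVf ?normr_eq0// mul1e.
  move=> X oX; transitivity (`|a|%:E * mu (phi @^-1` X))%E; last by [].
  by rewrite lebesgue_measure_affine_preimage// muleA -EFinM divff ?normr_eq0// mul1e.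
have := @ge0_integral_pushforward _ _ _ _ R _ mphi mu setT f measurableT mf.
rewrite preimage_setT /= => <-; last by move=> x _; exact: f0.
rewrite (eq_measure_integral (mscale (NngNum nai0) mu)); last by move=> A mA _; exact: pushE.
by rewrite ge0_integral_mscale.
Qed.

Lemma ge0_integral_dilate (a : R) (f : R -> \bar R) : a != 0 ->
  measurable_fun setT f -> (forall x, 0 <= f x)%E ->
  (\int[mu]_x f (x * a)%R = (`|a|^-1)%:E * \int[mu]_x f x)%E.
Proof.
move=> a0 mf f0; rewrite -(ge0_integral_affine 0 a0 mf f0).
by apply: eq_integral => x _; rewrite addr0.
Qed.

(* Both sides of the distributivity law below are -oo when x = y = +oo. *)
Lemma ge0_muleBr (c : R) (x y : \bar R) : 0 <= c -> (0 <= x)%E -> (0 <= y)%E ->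
  (c%:E * (x - y) = c%:E * x - c%:E * y)%E.
Proof.
rewrite le_eqVlt => /predU1P[<- _ _|c0]; first by rewrite !mul0e oppe0 adde0.
by case: x => [x||]//; case: y => [y||]// _ _;
  rewrite /= ?gt0_muley ?gt0_muleNy ?lte_fin// -?EFinM -?EFinB ?mulrBr.
Qed.

Lemma integral_dilate (a : R) (f : R -> \bar R) : a != 0 -> measurable_fun setT f ->
  (\int[mu]_x f (x * a)%R = (`|a|^-1)%:E * \int[mu]_x f x)%E.
Proof.
move=> a0 mf; rewrite integralE [in RHS]integralE ge0_muleBr ?invr_ge0 ?integral_ge0//.
rewrite -(ge0_integral_dilate a0 (measurable_funepos mf))//.
rewrite -(ge0_integral_dilate a0 (measurable_funeneg mf))//.
by congr (_ - _)%E; apply: eq_integral => x _; rewrite ?funeposE ?funenegE.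
Qed.

Lemma integral_ge0Zl (c : R) (f : R -> \bar R) : 0 <= c -> measurable_fun setT f ->
  (\int[mu]_x (c%:E * f x) = c%:E * \int[mu]_x f x)%E.
Proof.
move=> c0 mf; rewrite integralE [in RHS]integralE ge0_muleBr ?integral_ge0//.
rewrite -!ge0_integralZl_EFin//; [|exact: (measurable_funeneg mf)|exact: (measurable_funepos mf)].
congr (_ - _)%E; apply: eq_integral => x _.
- by rewrite !funeposE maxe_pMr ?mule0// lee_fin.
- by rewrite !funenegE -muleN maxe_pMr ?mule0// lee_fin.
Qed.

End affine_change_of_variables.

Section haar_integral.
Variable R : realType.
Local Notation mu := (@lebesgue_measure R).
Implicit Types f g : R -> \bar R.

(* The Haar measure of the multiplicative group of the field R. Its density vanishes at 0,
   where the inverse has the junk value 0. *)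
Definition haar_integral (f : R -> \bar R) : \bar R := (\int[mu]_x ((`|x|^-1)%:E * f x))%E.

Lemma haar_integral_ge0 f : (forall x, 0 <= f x)%E -> (0 <= haar_integral f)%E.
Proof. by move=> f0; rewrite /haar_integral; positivity. Qed.

Lemma eq_haar_integral f g : (forall x, x != 0 -> f x = g x) ->
  haar_integral f = haar_integral g.
Proof.
move=> fg; apply: eq_integral => x _.
by have [->|/fg->//] := eqVneq x 0; rewrite normr0 invr0 !mul0e.
Qed.

Lemma ge0_haar_integralZl (c : \bar R) f : (0 <= c)%E ->
  measurable_fun setT f -> (forall x, 0 <= f x)%E ->
  haar_integral (fun x => c * f x)%E = (c * haar_integral f)%E.
Proof.
move=> c0 mf f0; rewrite /haar_integral -ge0_integralZl//.
by apply: eq_integral => x _; rewrite muleCA.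
Qed.

Lemma haar_integral_dilate (a : R) f : a != 0 ->
  measurable_fun setT f -> (forall x, 0 <= f x)%E ->
  haar_integral (fun x => f (x * a)) = haar_integral f.
Proof.
move=> a0 mf f0; have na0 : `|a| != 0 by rewrite normr_eq0.
rewrite /haar_integral.
transitivity (\int[mu]_x (`|a|%:E * ((`|x * a|^-1)%:E * f (x * a)%R)))%E.
  apply: eq_integral => x _; rewrite muleA -EFinM; congr (_%:E * _)%E.
  by rewrite normrM invfM mulrCA divff ?mulr1.
rewrite ge0_integralZl_EFin//.
rewrite (@ge0_integral_dilate _ a (fun x => (`|x|^-1)%:E * f x)%E)//.
by rewrite muleA -EFinM divff// mul1e.
Qed.

Lemma haar_integral_tonelli (f : R * R -> \bar R) :
  measurable_fun setT f -> (forall z, 0 <= f z)%E ->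
  haar_integral (fun x => haar_integral (fun y => f (x, y))) =
  haar_integral (fun y => haar_integral (fun x => f (x, y))).
Proof.
move=> mf f0; pose g (z : R * R) := ((`|z.1|^-1)%:E * ((`|z.2|^-1)%:E * f z))%E.
have g0 z : (0 <= g z)%E by rewrite /g.
have mfx x : measurable_fun setT (fun y : R => f (x, y)) by [].
have mfy y : measurable_fun setT (fun x : R => f (x, y)) by [].
transitivity (\int[mu]_x \int[mu]_y g (x, y))%E.
  by apply: eq_integral => x _; rewrite /haar_integral -ge0_integralZl_EFin ?invr_ge0.
rewrite (@fubini_tonelli _ _ (measurableTypeR R) (measurableTypeR R) R mu mu g)//.
apply: eq_integral => y _; rewrite /haar_integral -ge0_integralZl_EFin ?invr_ge0//.
by apply: eq_integral => x _; rewrite /g/= muleCA.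
Qed.

Lemma measurable_indic_12 : measurable_fun setT (fun x : R => (\1_`[1, 2] x : R)%:E).
Proof. by apply/measurable_EFinP; exact: measurable_indic. Qed.

Lemma haar_integral_indic_12_bounds : (0 < haar_integral (fun x => (\1_`[1, 2] x : R)%:E) < +oo)%E.
Proof.
have mI := measurable_indic_12.
have I1 : (\int[mu]_x (\1_`[1, 2] x : R)%:E = 1)%E.
  rewrite integral_indic// setIT [LHS](_ : _ = mu `[1, 2]%classic)//.
  by rewrite lebesgue_measure_itv/= lte_fin ltr1n -EFinD; congr EFin; lra.
apply/andP; split.
- apply: (@lt_le_trans _ _ (\int[mu]_x (2^-1%:E * (\1_`[1, 2] x : R)%:E))%E).
    by rewrite ge0_integralZl_EFin// I1 mule1 lte_fin.
  apply: ge0_le_integral => //=.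
  move=> x _; rewrite -!EFinM lee_fin indicE.
  have [|] := boolP (x \in `[1, 2]%classic); last by rewrite !mulr0.
  rewrite inE /= in_itv/= => /andP[x1 x2]; have x0 := lt_le_trans ltr01 x1.
  by rewrite !mulr1 gtr0_norm// lef_pV2 ?posrE.
- apply: (@le_lt_trans _ _ 1%E); last exact: ltry.
  rewrite -I1; apply: ge0_le_integral => //=.
  move=> x _; rewrite -!EFinM lee_fin indicE.
  have [|] := boolP (x \in `[1, 2]%classic); last by rewrite !mulr0.
  rewrite inE /= in_itv/= => /andP[x1 x2]; have x0 := lt_le_trans ltr01 x1.
  by rewrite mulr1 gtr0_norm// invf_le1.
Qed.

(* Uniqueness of the Haar measure: for an auxiliary g, the invariance under dilations and Tonelli
   turn the product of the integrals of f and g into that of the integrals of f (x^-1) and g. *)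
Lemma ge0_haar_integral_inv f : measurable_fun setT f -> (forall x, 0 <= f x)%E ->
  haar_integral (fun x => f x^-1) = haar_integral f.
Proof.
move=> mf f0; pose g (x : R) : \bar R := (\1_`[1, 2] x : R)%:E.
have mg : measurable_fun setT g := measurable_indic_12.
have g0 x : (0 <= g x)%E by rewrite lee_fin.
have convolution : (haar_integral g * haar_integral f =
    haar_integral g * haar_integral (fun x => f (x^-1)%R))%E.
  transitivity (haar_integral (fun u => haar_integral (fun x => g u * f (x / u)%R))%E).
    rewrite muleC -ge0_haar_integralZl ?haar_integral_ge0//; apply: eq_haar_integral => u u0.
    rewrite ge0_haar_integralZl// muleC.
    by congr (_ * _)%E; rewrite (haar_integral_dilate (invr_neq0 u0)).
  rewrite (@haar_integral_tonelli (fun z => g z.1 * f (z.2 / z.1)%R)%E)//.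
  transitivity (haar_integral (fun x => haar_integral (fun u => g (u * x)%R * f (u^-1)%R))%E).
    apply: eq_haar_integral => x x0.
    rewrite -(@haar_integral_dilate x (fun u => g u * f (x / u)%R)%E)//=.
    by apply: eq_haar_integral => u u0; rewrite invfM mulrCA divff ?mulr1.
  rewrite (@haar_integral_tonelli (fun z => g (z.2 * z.1)%R * f (z.2^-1)%R)%E)//.
  rewrite -ge0_haar_integralZl ?haar_integral_ge0//.
  apply: eq_haar_integral => u u0; rewrite [RHS]muleC -(haar_integral_dilate u0 mg g0).
  by rewrite -ge0_haar_integralZl//; apply: eq_haar_integral => x _; rewrite /= muleC mulrC.
have /andP[c0 cy] := haar_integral_indic_12_bounds.
have /(congr1 (fun y => y / haar_integral g)%E) := convolution.
have cfin : haar_integral g \is a fin_num by rewrite ge0_fin_numE ?haar_integral_ge0.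
by rewrite !(muleC (haar_integral g)) -!muleA divee ?gt_eqF// !mule1 => ->.
Qed.

Lemma haar_integral_inv f : measurable_fun setT f ->
  haar_integral (fun x => f x^-1) = haar_integral f.
Proof.
move=> mf; have haar_integralE g :
    haar_integral g = (haar_integral g^\+ - haar_integral g^\-)%E.
  rewrite /haar_integral integralE; congr (_ - _)%E; apply: eq_integral => x _.
  - by rewrite !funeposE maxe_pMr ?mule0// lee_fin invr_ge0.
  - by rewrite !funenegE -muleN maxe_pMr ?mule0// lee_fin invr_ge0.
rewrite (haar_integralE f) -(ge0_haar_integral_inv (measurable_funepos mf))//.
rewrite -(ge0_haar_integral_inv (measurable_funeneg mf))//.
rewrite haar_integralE; congr (haar_integral _ - haar_integral _)%E; apply/funext => x.
- by rewrite !funeposE.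
- by rewrite !funenegE.
Qed.

End haar_integral.

(** * Integrability of powers *)

Section power_integrals.
Variable R : realType.
Local Notation mu := (@lebesgue_measure R).

Lemma is_derive_powR (c x : R) : 0 < x ->
  is_derive x 1 (fun y : R => y `^ c) (c * x `^ (c - 1)).
Proof.
move=> x0; have xin : x \in `]0, +oo[ by rewrite in_itv/= x0.
by apply: DeriveDef; [exact: derivable_powR|rewrite -derive1E powR_derive1].
Qed.

Lemma is_derive_1B_powR (c x : R) : x < 1 ->
  is_derive x 1 (fun y : R => (1 - y) `^ c) (- (c * (1 - x) `^ (c - 1))).
Proof.
move=> x1; have x0 : 0 < 1 - x by rewrite subr_gt0.
have dB : is_derive x 1 (fun y : R => 1 - y) (-1).
  apply: (@is_derive_eq _ _ _ _ _ _ _ _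
    (@is_deriveB R R R (cst 1) id x 1 _ _ (is_derive_cst _ _ _) (is_derive_id _ _))).
  by rewrite sub0r.
have := @is_derive1_comp R (fun y => y `^ c) (fun y : R => 1 - y) x _ _ (is_derive_powR c x0) dB.
by rewrite mulrN1.
Qed.

Lemma is_derive_continuous (h : R -> R) (x d : R) : is_derive x 1 h d -> {for x, continuous h}.
Proof. by move=> [dh _]; apply: differentiable_continuous; apply/derivable1_diffP. Qed.

Lemma cvg_powR_neg (a : R) : a < 0 -> x `^ a @[x --> +oo] --> (0 : R).
Proof.
rewrite -oppr_gt0 -{2}(opprK a); move: (- a) => c c0; apply/cvgr0Pnorm_lt => e e0; near=> x.
have x0 : 0 < x by near: x; exact: nbhs_pinfty_gt.
rewrite ger0_norm ?powR_ge0// powRN invf_plt ?posrE ?powR_gt0//.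
have -> : e^-1 = (e^-1 `^ c^-1) `^ c.
  by rewrite -powRrM mulVf ?gt_eqF// powRr1// invr_ge0 ltW.
by rewrite gt0_ltr_powR// ?nnegrE ?powR_ge0// ?(ltW x0).
Unshelve. all: by end_near. Qed.

Lemma integral_powR_1y_lty (b : R) : b < -1 ->
  (\int[mu]_x (if 1 <= x then x `^ b else 0)%:E < +oo)%E.
Proof.
move=> b1; have c0 : b + 1 < 0 by rewrite -ltrBrDr sub0r.
pose F (x : R) : R := (b + 1)^-1 * x `^ (b + 1).
have dF (x : R) : 0 < x -> is_derive x 1 F (x `^ b).
  move=> x0; have d1 := is_derive_powR (b + 1) x0.
  by apply: is_derive_eq; rewrite /GRing.scale/= mulrA mulVf ?lt_eqF// mul1r addrK.
rewrite (_ : (\int[mu]_x _ = \int[mu]_(x in `[1%R, +oo[) (x `^ b)%:E)%E); last first.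
  rewrite [RHS]integral_mkcond; apply: eq_integral => x _.
  by rewrite patchE mem_setE in_itv/= andbT; case: ifPn.
rewrite (@ge0_continuous_FTC2y R (fun x => x `^ b) F 1 0) ?ltry//.
- apply: continuous_in_subspaceT => x; rewrite inE/= in_itv/= andbT => x1.
  exact: is_derive_continuous (is_derive_powR b (lt_le_trans ltr01 x1)).
- by rewrite -(mulr0 (b + 1)^-1); apply: cvgM; [exact: cvg_cst|exact: cvg_powR_neg].
- by move=> x x1; have [] := dF _ (lt_trans ltr01 x1).
- exact: cvg_at_right_filter (is_derive_continuous (dF _ ltr01)).
- move=> x; rewrite in_itv/= andbT => x1; rewrite derive1E.
  by have [_ ->] := dF _ (lt_trans ltr01 x1).
Qed.

Lemma integral_normr_powR_1y_lty (b : R) : b < -1 ->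
  (\int[mu]_x (if 1 <= `|x| then `|x| `^ b else 0)%:E < +oo)%E.
Proof.
move=> b1; pose h (x : R) := if 1 <= x then x `^ b else 0.
have h0 x : 0 <= h x by rewrite /h; positivity.
apply: (@le_lt_trans _ _ (\int[mu]_x ((h x)%:E + (h (x * -1))%:E))%E).
  apply: ge0_le_integral => //.
  move=> x _; rewrite -EFinD lee_fin mulrN1.
  by case: (ger0P x) => _; rewrite -/(h _) ?lerDl ?lerDr.
rewrite ge0_integralD//.
rewrite (@ge0_integral_dilate _ (-1) (fun x => (h x)%:E))// ?oppr_eq0 ?oner_eq0//.
by rewrite normrN normr1 invr1 mul1e lte_add_pinfty ?integral_powR_1y_lty.
Qed.

Lemma integral_normr_powR_01_lty (a : R) : -1 < a ->
  (\int[mu]_x (if 0 < `|x| < 1 then `|x| `^ a else 0)%:E < +oo)%E.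
Proof.
move=> a1; pose h (x : R) := (if 0 < `|x| < 1 then `|x| `^ (a + 1) else 0)%:E.
have h0 x : (0 <= h x)%E by rewrite /h; positivity.
rewrite (_ : (\int[mu]_x _ = haar_integral h)%E); last first.
  apply: eq_integral => x _; rewrite /h -EFinM; congr EFin.
  case: ifPn => [/andP[x0 _]|]; last by rewrite mulr0.
  by rewrite powRD ?(gt_eqF x0) ?implybT// powRr1// mulrCA mulVf ?mulr1 ?gt_eqF.
rewrite -ge0_haar_integral_inv//.
have b1 : - (a + 1) - 1 < -1 by lra.
apply: le_lt_trans (integral_normr_powR_1y_lty b1).
apply: ge0_le_integral => //.
move=> x _; rewrite /h -EFinM lee_fin normfV invr_gt0.
have [x0|x0] := ltP 0 `|x|; last by rewrite mulr0; positivity.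
rewrite invf_lt1//; have [x1|x1] := ltP 1 `|x|; last by rewrite mulr0; positivity.
rewrite (ltW x1) -(powR_inv1 (ltW x0)) -powRrM -powRD ?(gt_eqF x0) ?implybT//.
by rewrite mulN1r addrC.
Qed.

Definition broken_power (a b y : R) : R :=
  if 0 < `|y| < 1 then `|y| `^ a else if 1 <= `|y| then `|y| `^ b else 0.

Lemma broken_power_ge0 a b y : 0 <= broken_power a b y.
Proof. by rewrite /broken_power; positivity. Qed.

Lemma broken_power0 a b : broken_power a b 0 = 0.
Proof. by rewrite /broken_power normr0 ltxx/= ler10. Qed.

Lemma broken_powerN a b y : broken_power a b (- y) = broken_power a b y.
Proof. by rewrite /broken_power normrN. Qed.

Lemma measurable_broken_power a b : measurable_fun setT (broken_power a b).
Proof. by rewrite /broken_power. Qed.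

Lemma broken_power_powR a b c y : c != 0 ->
  broken_power a b y `^ c = broken_power (a * c) (b * c) y.
Proof.
move=> c0; rewrite /broken_power; case: ifPn => _; first by rewrite powRrM.
by case: ifPn => _; [rewrite powRrM|rewrite powR0].
Qed.

Lemma broken_powerM a b c y : broken_power a b y * `|y| `^ c = broken_power (a + c) (b + c) y.
Proof.
have [->|y0] := eqVneq y 0; first by rewrite !broken_power0 mul0r.
have ny0 : `|y| != 0 by rewrite normr_eq0.
by rewrite /broken_power; do 2?case: ifPn => _; rewrite ?mul0r// powRD// ny0 implybT.
Qed.

Lemma integral_broken_power_lty a b : -1 < a -> b < -1 ->
  (\int[mu]_y (broken_power a b y)%:E < +oo)%E.
Proof.
move=> a1 b1.
pose inner (y : R) := if 0 < `|y| < 1 then `|y| `^ a else 0.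
pose outer (y : R) := if 1 <= `|y| then `|y| `^ b else 0.
have inner0 y : 0 <= inner y by rewrite /inner; positivity.
have outer0 y : 0 <= outer y by rewrite /outer; positivity.
rewrite (_ : (\int[mu]_y _ = \int[mu]_y ((inner y)%:E + (outer y)%:E))%E); last first.
  apply: eq_integral => y _; rewrite -EFinD /broken_power /inner /outer; congr EFin.
  by case: ifPn => [/andP[_]|_]; rewrite ?add0r// ltNge => /negbTE ->; rewrite addr0.
rewrite ge0_integralD//.
by rewrite lte_add_pinfty ?integral_normr_powR_01_lty ?integral_normr_powR_1y_lty.
Qed.

Lemma powR_half_itv_le (g x : R) : 2^-1 <= x <= 1 -> x `^ g <= 1 + 2^-1 `^ g.
Proof.
move=> /andP[x2 x1]; have x0 : 0 < x by exact: lt_le_trans x2.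
have [g0|g0] := leP 0 g.
  have -> : 1 = 1 `^ g :> R by rewrite powR1.
  by rewrite (@le_trans _ _ (1 `^ g)) ?lerDl ?powR_ge0// ge0_ler_powR ?nnegrE// ltW.
rewrite (@le_trans _ _ (2^-1 `^ g)) ?lerDr// -[g]opprK !(powRN _ (- g)).
rewrite lef_pV2 ?posrE ?powR_gt0// ge0_ler_powR ?nnegrE ?oppr_ge0 ?(ltW g0)//.
exact: ltW.
Qed.

Lemma integral_beta_lty (a b : R) : -1 < a -> -1 < b ->
  (\int[mu]_x (if 0 < x < 1 then x `^ a * (1 - x) `^ b else 0)%:E < +oo)%E.
Proof.
move=> a1 b1; pose e (c : R) := broken_power c (-2).
have me c : measurable_fun setT (e c) := measurable_broken_power c (-2).
have e0 c x : 0 <= e c x by exact: broken_power_ge0.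
have eE c x : 0 < x < 1 -> e c x = x `^ c.
  by move=> /andP[x0 x1]; rewrite /e /broken_power gtr0_norm// x0 x1.
pose C (c : R) := 1 + 2^-1 `^ c; have C0 c : 0 <= C c by rewrite /C; positivity.
apply: (@le_lt_trans _ _
  (\int[mu]_x ((C b)%:E * (e a x)%:E + (C a)%:E * (e b (x * -1 + 1)%R)%:E))%E).
  apply: ge0_le_integral => //.
  move=> x _; rewrite -!EFinM -EFinD lee_fin (_ : x * -1 + 1 = 1 - x); last by ring.
  case: ifPn => [/andP[x0 x1]|_]; last by rewrite addr_ge0 ?mulr_ge0.
  rewrite !eE; [|by apply/andP; split; lra..].
  have [xh|xh] := leP x 2^-1.
    rewrite (@le_trans _ _ (C b * x `^ a)) ?lerDl ?mulr_ge0 ?powR_ge0//.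
    by rewrite mulrC ler_wpM2r ?powR_ge0// powR_half_itv_le//; apply/andP; split; lra.
  rewrite (@le_trans _ _ (C a * (1 - x) `^ b)) ?lerDr ?mulr_ge0 ?powR_ge0//.
  by rewrite ler_wpM2r ?powR_ge0// powR_half_itv_le//; apply/andP; split; lra.
have Ie c : -1 < c -> (\int[mu]_x (e c x)%:E < +oo)%E.
  by move=> c1; apply: integral_broken_power_lty => //; lra.
rewrite ge0_integralD//=.
rewrite !ge0_integralZl_EFin//.
rewrite (@ge0_integral_affine R (-1) 1 (fun x => (e b x)%:E))// ?oppr_eq0 ?oner_eq0//.
by rewrite normrN normr1 invr1 mul1e lte_add_pinfty// lte_mul_pinfty ?Ie.
Qed.

End power_integrals.

(** * Integral inequalities *)

Lemma ge0_le_poweR (R : realType) (x y : \bar R) (r : R) : 0 <= r -> (0 <= x)%E -> (x <= y)%E ->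
  (x `^ r <= y `^ r)%E.
Proof.
move=> r0 x0 xy; apply: gt0_ler_poweR => //; rewrite in_itv/= leey andbT//.
exact: le_trans xy.
Qed.

Section Lnorm.
Context d (T : measurableType d) (R : realType).
Variable mu : {measure set T -> \bar R}.
Implicit Types f g : T -> \bar R.
Local Notation "''N_' q [ f ]" := (Lnorm mu q%:E f).

Lemma ge0_poweR_Lnorm (q : R) f : q != 0 -> (forall x, 0 <= f x)%E ->
  ('N_q[f] `^ q = \int[mu]_x (f x `^ q))%E.
Proof.
by move=> q0 f0; rewrite poweR_Lnorm//; apply: eq_integral => x _; rewrite gee0_abs.
Qed.

Lemma ge0_LnormE (q : R) f : (forall x, 0 <= f x)%E ->
  ('N_q[f] = (\int[mu]_x (f x `^ q)) `^ q^-1)%E.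
Proof.
move=> f0; rewrite unlock; congr (_ `^ _)%E.
by apply: eq_integral => x _; rewrite gee0_abs.
Qed.

Lemma ge0_ae_le_Lnorm (q : R) f g : 0 < q -> measurable_fun setT f -> measurable_fun setT g ->
  (forall x, 0 <= f x)%E -> (forall x, 0 <= g x)%E ->
  {ae mu, forall x, (f x <= g x)%E} -> ('N_q[f] <= 'N_q[g])%E.
Proof.
move=> q0 mf mg f0 g0 fg; rewrite !ge0_LnormE//; apply: ge0_le_poweR.
- by rewrite invr_ge0 ltW.
- exact: integral_ge0.
apply: ae_ge0_le_integral => //.
by apply: filterS fg => x fgx _; apply: ge0_le_poweR => //; exact: ltW.
Qed.

Lemma ge0_LnormZl (q c : R) f : 0 < q -> 0 <= c -> measurable_fun setT f ->
  (forall x, 0 <= f x)%E -> ('N_q[(fun x => c%:E * f x)] = c%:E * 'N_q[f])%E.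
Proof.
move=> q0 c0 mf f0; rewrite !ge0_LnormE//.
under eq_integral => x _ do rewrite poweRM//.
rewrite ge0_integralZl// poweRM ?integral_ge0//.
by rewrite -poweRrM divff ?gt_eqF// poweRe1// lee_fin.
Qed.

Lemma ge0_jensen (q : R) (W F : T -> R) : 1 <= q ->
  measurable_fun setT W -> measurable_fun setT F ->
  (forall x, 0 <= W x) -> (forall x, 0 <= F x) ->
  ((\int[mu]_x (W x * F x)%:E) `^ q <=
   (\int[mu]_x (W x)%:E) `^ (q - 1) * \int[mu]_x (W x * F x `^ q)%:E)%E.
Proof.
rewrite le_eqVlt => /predU1P[<- mW mF W0 F0|q1 mW mF W0 F0].
  rewrite subrr poweRe0 mul1e poweRe1//.
  by under [leRHS]eq_integral do rewrite powRr1//.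
have q0 : 0 < q by rewrite (lt_trans _ q1).
have q10 : 0 < q - 1 by rewrite subr_gt0.
pose p := q / (q - 1); have p0 : 0 < p by rewrite divr_gt0.
have pq : p^-1 + q^-1 = 1 by rewrite /p; field; rewrite !gt_eqF.
have rootK (r x : R) : 0 < r -> 0 <= x -> x `^ r^-1 `^ r = x.
  by move=> r0 x0; rewrite -powRrM mulVf ?gt_eqF// powRr1.
pose F1 x := W x `^ p^-1; pose F2 x := W x `^ q^-1 * F x.
have F10 x : (0 <= (F1 x)%:E)%E by rewrite /F1.
have F20 x : (0 <= (F2 x)%:E)%E by rewrite /F2.
have -> : (\int[mu]_x (W x * F x)%:E = 'N[mu]_1[EFin \o (F1 \* F2)%R])%E.
  rewrite Lnorm1; apply: eq_integral => x _ /=; rewrite /F1 /F2.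
  rewrite ger0_norm ?mulr_ge0 ?powR_ge0// mulrA -powRD ?pq ?powRr1//.
  by rewrite oner_eq0.
apply: (@le_trans _ _ (('N_p[EFin \o F1] * 'N_q[EFin \o F2]) `^ q)%E).
  by apply: ge0_le_poweR; rewrite ?(ltW q0) ?Lnorm_ge0 ?hoelder.
rewrite poweRM// [X in (_ * X)%E]ge0_poweR_Lnorm ?gt_eqF// ge0_LnormE// -poweRrM.
rewrite (_ : p^-1 * q = q - 1); last by rewrite /p; field; rewrite !gt_eqF.
under eq_integral do rewrite poweR_EFin /F1 rootK//.
under [X in (_ * X <= _)%E]eq_integral do rewrite poweR_EFin /F2 powRM// rootK//.
exact: lexx.
Qed.

(* Jensen for the density [V * c] and the function [F / c]. *)
Lemma ge0_jensen_weighted (q : R) (V c F : T -> R) : 1 <= q ->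
  measurable_fun setT V -> measurable_fun setT c -> measurable_fun setT F ->
  (forall x, 0 <= V x) -> (forall x, 0 <= F x) -> (forall x, V x != 0 -> 0 < c x) ->
  ((\int[mu]_x (V x * F x)%:E) `^ q <=
   (\int[mu]_x (V x * c x)%:E) `^ (q - 1) *
     \int[mu]_x (V x * c x `^ (1 - q) * F x `^ q)%:E)%E.
Proof.
move=> q1 mV mc mF V0 F0 c0.
have Vc0 x : 0 <= V x * c x.
  by have [->|/c0/ltW c0x] := eqVneq (V x) 0; rewrite ?mul0r ?mulr_ge0.
have -> : (\int[mu]_x (V x * F x)%:E = \int[mu]_x ((V x * c x) * (F x / `|c x|))%:E)%E.
  apply: eq_integral => x _; congr EFin.
  have [->|/c0 c0x] := eqVneq (V x) 0; first by rewrite !mul0r.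
  by rewrite gtr0_norm// -mulrA (mulrCA (c x)) divff ?mulr1// gt_eqF.
have -> : (\int[mu]_x (V x * c x `^ (1 - q) * F x `^ q)%:E =
    \int[mu]_x ((V x * c x) * (F x / `|c x|) `^ q)%:E)%E.
  apply: eq_integral => x _; congr EFin.
  have [->|/c0 c0x] := eqVneq (V x) 0; first by rewrite !mul0r.
  rewrite gtr0_norm// powRM ?invr_ge0 ?(ltW c0x)// -(powR_inv1 (ltW c0x)) -powRrM mulN1r.
  rewrite (mulrC (F x `^ q)) [RHS]mulrA -[in RHS](mulrA (V x)); congr (_ * _ * _).
  by rewrite -{2}(powRr1 (ltW c0x)) -powRD// (gt_eqF c0x) implybT.
by apply: ge0_jensen => // x; rewrite divr_ge0.
Qed.

End Lnorm.

Section minkowski_integral.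
Context d1 d2 (T1 : measurableType d1) (T2 : measurableType d2) (R : realType).
Variables (m1 : {sigma_finite_measure set T1 -> \bar R}).
Variables (m2 : {sigma_finite_measure set T2 -> \bar R}).

(* The majorant c of the norms of the Phi (u, _) avoids any discussion of the points u where that
   norm is zero or infinite. *)
Lemma minkowski_integral_le (q : R) (V c : T1 -> R) (Phi : T1 * T2 -> R) (M : \bar R) :
  1 <= q -> measurable_fun setT V -> measurable_fun setT c -> measurable_fun setT Phi ->
  (forall u, 0 <= V u) -> (forall z, 0 <= Phi z) -> (0 <= M)%E ->
  (forall u, V u != 0 -> 0 < c u) ->
  (forall u, V u != 0%R -> 'N[m2]_q%:E[(fun t => (Phi (u, t))%:E)] <= (c u)%:E * M)%E ->
  (\int[m1]_u (V u * c u)%:E < +oo)%E ->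
  ('N[m2]_q%:E[(fun t => \int[m1]_u (V u * Phi (u, t))%:E)] <=
     (\int[m1]_u (V u * c u)%:E) * M)%E.
Proof.
move=> q1 mV mc mPhi V0 Phi0 M0 c0 PhiM mass_fin.
have q0 : 0 < q by exact: lt_le_trans q1.
set mass := (\int[m1]_u (V u * c u)%:E)%E in mass_fin *.
have Vc0 u : 0 <= V u * c u.
  by have [->|/c0/ltW c0u] := eqVneq (V u) 0; rewrite ?mul0r ?mulr_ge0.
have mass0 : (0 <= mass)%E by apply: integral_ge0 => u _; rewrite lee_fin.
pose G (z : T1 * T2) : R := V z.1 * c z.1 `^ (1 - q) * Phi z `^ q.
have G0 z : 0 <= G z by rewrite /G; positivity.
have mG : measurable_fun setT (EFin \o G) by [].
have GM u : (\int[m2]_t (G (u, t))%:E <= (V u * c u)%:E * (M `^ q))%E.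
  have [Vu0|Vu0] := eqVneq (V u) 0.
    by rewrite Vu0 mul0r mul0e integral0_eq// => t _; rewrite /G/= Vu0 !mul0r.
  have c0u := c0 _ Vu0; under eq_integral => t _ do rewrite /G/= EFinM -poweR_EFin.
  rewrite ge0_integralZl_EFin//; last by rewrite mulr_ge0 ?powR_ge0.
  rewrite -(@ge0_poweR_Lnorm _ _ _ m2 q (fun t => (Phi (u, t))%:E)) ?gt_eqF//.
  apply: (@le_trans _ _ ((V u * c u `^ (1 - q))%:E * ((c u)%:E * M) `^ q)%E).
    rewrite lee_wpmul2l ?lee_fin ?mulr_ge0 ?powR_ge0//.
    by apply: ge0_le_poweR; [exact: ltW|exact: Lnorm_ge0|exact: PhiM].
  rewrite poweRM ?lee_fin ?(ltW c0u)// poweR_EFin muleA -EFinM -mulrA.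
  rewrite -powRD ?(gt_eqF c0u) ?implybT//.
  by rewrite subrK powRr1// ltW.
have norm_le : (\int[m2]_t ((\int[m1]_u (V u * Phi (u, t))%:E) `^ q) <= (mass * M) `^ q)%E.
  apply: (@le_trans _ _ (\int[m2]_t (mass `^ (q - 1) * \int[m1]_u (G (u, t))%:E))%E).
    by apply: ge0_le_integral => // t _; exact: ge0_jensen_weighted.
  rewrite ge0_integralZl//.
  rewrite -(fubini_tonelli (EFin \o G))//.
  apply: (@le_trans _ _ (mass `^ (q - 1) * \int[m1]_u ((V u * c u)%:E * (M `^ q)))%E).
    by rewrite lee_wpmul2l ?poweR_ge0//; apply: ge0_le_integral => // u _; exact: GM.
  rewrite ge0_integralZr// => [|u _]; last by rewrite lee_fin.
  rewrite -/mass poweRM// muleA -(fineK (_ : mass \is a fin_num)) ?ge0_fin_numE//.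
  by rewrite !poweR_EFin -EFinM mulrC mulr_powRB1// fine_ge0.
rewrite ge0_LnormE//; apply: le_trans (ge0_le_poweR _ _ norm_le) _.
- by rewrite invr_ge0 ltW.
- exact: integral_ge0.
by rewrite -poweRrM divff ?gt_eqF// poweRe1// mule_ge0.
Qed.

End minkowski_integral.

(** * Complex-valued integrals *)

Section complex_integral.
Variable R : realType.
Local Notation mu := (@lebesgue_measure R).
Implicit Types (f g : R -> R[i]) (z w : R[i]).

Lemma lebesgue_aeS (P Q : R -> Prop) : (forall x, P x -> Q x) ->
  {ae mu, forall x, P x} -> {ae mu, forall x, Q x}.
Proof. by move=> PQ; apply: (@filterS _ _ (@ae_filter_ringOfSetsType _ _ R mu)). Qed.

Lemma lebesgue_aeS2 (P Q S : R -> Prop) : (forall x, P x -> Q x -> S x) ->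
  {ae mu, forall x, P x} -> {ae mu, forall x, Q x} -> {ae mu, forall x, S x}.
Proof. by move=> PQS; apply: (@filterS2 _ _ (@ae_filter_ringOfSetsType _ _ R mu)). Qed.

Lemma ae_neq (a : R) : {ae mu, forall x, x != a}.
Proof.
exists [set a]; split => //; first exact: lebesgue_measure_set1.
by move=> x /=; move/negP; rewrite negbK => /eqP.
Qed.

Lemma lebesgue_tonelli (F : R -> R -> \bar R) : measurable_fun setT (fun z : R * R => F z.1 z.2) ->
  (forall x y, 0 <= F x y)%E -> (\int[mu]_x \int[mu]_y F x y = \int[mu]_y \int[mu]_x F x y)%E.
Proof.
move=> mF F0; pose f (xy : R * R) := F xy.1 xy.2.
have f0 xy : (0 <= f xy)%E by exact: F0.
exact: (@fubini_tonelli _ _ (measurableTypeR R) (measurableTypeR R) R mu mu f mF f0).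
Qed.

Lemma Rintegral_fubini (F : R * R -> R) : measurable_fun setT F ->
  (\int[mu]_x \int[mu]_y `|(F (x, y))%:E| < +oo)%E ->
  Rintegral mu setT (fun x => Rintegral mu setT (fun y => F (x, y))) =
  Rintegral mu setT (fun y => Rintegral mu setT (fun x => F (x, y))).
Proof.
move=> mF Ffin; have mE : measurable_fun setT (EFin \o F) by [].
have IF : (mu \x mu)%E.-integrable setT (EFin \o F).
  exact/(@integrable12ltyP _ _ (measurableTypeR R) (measurableTypeR R) R mu mu (EFin \o F) mE).
have FE := @Fubini _ _ (measurableTypeR R) (measurableTypeR R) R mu mu (EFin \o F) IF.
rewrite /Rintegral; congr fine.
transitivity (\int[mu]_x \int[mu]_y (F (x, y))%:E)%E; last rewrite FE.
- apply: ae_eq_integral; first exact: measurableT.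
  + by apply/measurable_EFinP; apply: measurable_Rintegral_param.
  + exact: (@measurable_fubini_F _ _ (measurableTypeR R) (measurableTypeR R) R mu mu _ IF).
  + have := @ae_integrable1 _ _ (measurableTypeR R) (measurableTypeR R) R mu mu _ IF.
    by apply: filterS => x /= Fx _; rewrite fineK//; exact: integrable_fin_num.
- apply/esym; apply: ae_eq_integral; first exact: measurableT.
  + by apply/measurable_EFinP; apply: measurable_Rintegral_param.
  + exact: (@measurable_fubini_G _ _ (measurableTypeR R) (measurableTypeR R) R mu mu _ IF).
  + have := @ae_integrable2 _ _ (measurableTypeR R) (measurableTypeR R) R mu mu _ IF.
    by apply: filterS => x /= Fx _; rewrite fineK//; exact: integrable_fin_num.
Qed.

Lemma cintegral_mkcond (D : set R) f :
  cintegral D f = cintegral setT (fun x => (\1_D x)%:C * f x).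
Proof.
rewrite /cintegral; congr Complex; rewrite Rintegral_mkcond; apply: eq_Rintegral => x _;
  by rewrite patchE indicE complex_realM/=; case: ifPn => _; rewrite ?mul1r ?mul0r.
Qed.

Lemma eq_cintegral f g : f =1 g -> cintegral setT f = cintegral setT g.
Proof. by move=> fg; congr cintegral; apply/funext. Qed.

Lemma ae_eq_cintegral f g : cmeasurable_fun f -> cmeasurable_fun g ->
  {ae mu, forall x, f x = g x} -> cintegral setT f = cintegral setT g.
Proof.
move=> [mRef mImf] [mReg mImg] fg; rewrite /cintegral /Rintegral.
by congr (fine _ +i* fine _); apply: ae_eq_integral => //; apply: lebesgue_aeS fg => x ->.
Qed.

Lemma cintegral_ge0Zl (c : R) f : 0 <= c -> cmeasurable_fun f ->
  cintegral setT (fun x => c%:C * f x) = c%:C * cintegral setT f.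
Proof.
move=> c0 [mRe mIm]; rewrite /cintegral complex_realM/=.
have RintegralZ (h : R -> R) : measurable_fun setT h ->
    Rintegral mu setT (fun x => c * h x) = c * Rintegral mu setT h.
  move=> mh; rewrite /Rintegral; under eq_integral do rewrite EFinM.
  rewrite integral_ge0Zl//.
  by case: (\int[mu]_x _)%E => [x||]; rewrite ?mulr0//;
    have [->|c'] := eqVneq c 0; rewrite ?mul0e// ?gt0_muley ?gt0_muleNy ?lte_fin ?lt_def ?c' ?c0.
by congr Complex; under eq_Rintegral do rewrite complex_realM/=; rewrite RintegralZ.
Qed.

Lemma cintegral_dilate (a : R) f : a != 0 -> cmeasurable_fun f ->
  cintegral setT (fun x => f (x * a)) = (`|a|^-1)%:C * cintegral setT f.
Proof.
move=> a0 [mRe mIm]; rewrite -cintegral_ge0Zl ?invr_ge0//.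
have RintegralE (h : R -> R) : measurable_fun setT h ->
    Rintegral mu setT (fun x => h (x * a)) = Rintegral mu setT (fun x => `|a|^-1 * h x).
  move=> mh; rewrite /Rintegral; congr fine.
  under [RHS]eq_integral do rewrite EFinM.
  by rewrite integral_ge0Zl ?invr_ge0// -(@integral_dilate R a (EFin \o h)).
rewrite /cintegral; congr Complex; under [RHS]eq_Rintegral do rewrite complex_realM/=.
- exact: RintegralE mRe.
- exact: RintegralE mIm.
Qed.

Lemma cintegral_haar_inv f : cmeasurable_fun f ->
  cintegral setT (fun x => (`|x|^-1)%:C * f x^-1) = cintegral setT (fun x => (`|x|^-1)%:C * f x).
Proof.
move=> [mRe mIm].
have RintegralE (h : R -> R) : measurable_fun setT h ->
    Rintegral mu setT (fun x => `|x|^-1 * h x^-1) = Rintegral mu setT (fun x => `|x|^-1 * h x).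
  move=> mh; rewrite /Rintegral; congr fine.
  under eq_integral do rewrite EFinM; under [RHS]eq_integral do rewrite EFinM.
  exact: (@haar_integral_inv R (EFin \o h)).
rewrite /cintegral; congr Complex; under eq_Rintegral do rewrite complex_realM/=;
  under [RHS]eq_Rintegral do rewrite complex_realM/=.
- exact: RintegralE mRe.
- exact: RintegralE mIm.
Qed.

Definition cintegrable f : Prop :=
  cmeasurable_fun f /\ (\int[mu]_x (cnorm (f x))%:E < +oo)%E.

Lemma cintegrable_le f (h : R -> R) : cmeasurable_fun f -> measurable_fun setT h ->
  (forall x, cnorm (f x) <= h x) -> (\int[mu]_x (h x)%:E < +oo)%E -> cintegrable f.
Proof. by move=> mf mh fh hfin; split=> //; apply: le_lt_trans hfin; apply: ge0_le_integral. Qed.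

Lemma cintegrable_ReIm f : cintegrable f ->
  mu.-integrable setT (EFin \o (fun x => complex.Re (f x))) /\
  mu.-integrable setT (EFin \o (fun x => complex.Im (f x))).
Proof.
move=> [mf If]; have [mRe mIm] := mf.
have integrable_le (h : R -> R) : measurable_fun setT h -> (forall x, `|h x| <= cnorm (f x)) ->
    mu.-integrable setT (EFin \o h).
  move=> mh hf; apply/integrableP; split; first exact/measurable_EFinP.
  by apply: le_lt_trans If; apply: ge0_le_integral => //= x _; rewrite lee_fin.
by split; apply: integrable_le => // x; [exact: Re_le_cnorm|exact: Im_le_cnorm].
Qed.

Lemma cintegralD f g : cintegrable f -> cintegrable g ->
  cintegral setT (fun x => f x + g x) = cintegral setT f + cintegral setT g.
Proof.
move=> /cintegrable_ReIm[IRef IImf] /cintegrable_ReIm[IReg IImg].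
rewrite {1}/cintegral; under eq_Rintegral do rewrite ReD.
by under [X in _ +i* X]eq_Rintegral do rewrite ImD; rewrite !RintegralD.
Qed.

Lemma cintegralB f g : cintegrable f -> cintegrable g ->
  cintegral setT (fun x => f x - g x) = cintegral setT f - cintegral setT g.
Proof.
move=> /cintegrable_ReIm[IRef IImf] /cintegrable_ReIm[IReg IImg].
rewrite {1}/cintegral; under eq_Rintegral do rewrite ReB.
by under [X in _ +i* X]eq_Rintegral do rewrite ImB; rewrite !RintegralB.
Qed.

Lemma cintegrableMl z f : z != 0 -> cmeasurable_fun f ->
  cintegrable (fun x => z * f x) -> cintegrable f.
Proof.
move=> z0 mf [_]; under eq_integral do rewrite cnormM EFinM.
rewrite ge0_integralZl_EFin ?cnorm_ge0// => zf_fin; split=> //.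
have cz0 : 0 < cnorm z by rewrite -ltcR cnorm_normc normr_gt0.
by move: zf_fin; case: (\int[mu]_x _)%E => [x _||//]; rewrite ?ltry// gt0_muley.
Qed.

Lemma cintegralZl z f : cmeasurable_fun f -> cintegrable (fun x => z * f x) ->
  cintegral setT (fun x => z * f x) = z * cintegral setT f.
Proof.
move=> mf zf; have [->|z0] := eqVneq z 0.
  rewrite mul0r; under eq_cintegral do rewrite mul0r.
  by rewrite /cintegral /= !Rintegral_cst// mul0r.
have /cintegrable_ReIm[IRe IIm] := cintegrableMl z0 mf zf.
have integrableZ (c : R) (h : R -> R) : mu.-integrable setT (EFin \o h) ->
  mu.-integrable setT (EFin \o (fun x => c * h x)) by exact: (integrableZl measurableT).
case: z {zf z0} => a b; rewrite /cintegral.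
have zfE x : (a +i* b) * f x = (a * complex.Re (f x) - b * complex.Im (f x)) +i*
  (a * complex.Im (f x) + b * complex.Re (f x)) by case: (f x).
transitivity ((a * Rintegral mu setT (fun x => complex.Re (f x)) -
   b * Rintegral mu setT (fun x => complex.Im (f x))) +i*
  (a * Rintegral mu setT (fun x => complex.Im (f x)) +
   b * Rintegral mu setT (fun x => complex.Re (f x)))) => //.
congr Complex; under eq_Rintegral do rewrite zfE/=.
- by rewrite RintegralB ?RintegralZl//; exact: integrableZ.
- by rewrite RintegralD ?RintegralZl//; exact: integrableZ.
Qed.

(* With z the integral, |z|^2 is the integral of Re (z^* f), which is at most |z| |f|. *)
Lemma le_cnorm_cintegral f : cmeasurable_fun f ->
  ((cnorm (cintegral setT f))%:E <= \int[mu]_x (cnorm (f x))%:E)%E.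
Proof.
move=> mf; have [fin|] := ltP (\int[mu]_x (cnorm (f x))%:E)%E +oo%E; last first.
  by rewrite leye_eq => /eqP ->; rewrite leey.
set z := cintegral setT f; have [->//|z0] := eqVneq (cnorm z) 0.
have zp : 0 < cnorm z by rewrite lt_def z0 cnorm_ge0.
pose w := complex.Re z -i* complex.Im z.
have cw : cnorm w = cnorm z by rewrite /cnorm/= sqrrN.
have Iw : cintegrable (fun x => w * f x).
  have mwf : cmeasurable_fun (fun x => w * f x) by apply: cmeasurable_funM.
  split=> //; under eq_integral do rewrite cnormM EFinM.
  by rewrite ge0_integralZl_EFin ?cnorm_ge0// lte_mul_pinfty.
have In : mu.-integrable setT (EFin \o (fun x => cnorm (f x))).
  apply/integrableP; split=> //.
  by under eq_integral do rewrite /= ger0_norm ?cnorm_ge0//; exact: fin.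
rewrite -(fineK (_ : (\int[mu]_x (cnorm (f x))%:E)%E \is a fin_num)) ?ge0_fin_numE//.
rewrite lee_fin -(ler_pM2l zp).
have -> : cnorm z * cnorm z = complex.Re (cintegral setT (fun x => w * f x)).
  rewrite cintegralZl// -/z /w -expr2 sqr_sqrtr ?addr_ge0 ?sqr_ge0//.
  by case: (z) => a b /=; rewrite mulNr opprK !expr2.
rewrite -[X in cnorm z * X]/(Rintegral mu setT (fun x => cnorm (f x))) -RintegralZl//.
have [IRe _] := cintegrable_ReIm Iw.
apply: le_Rintegral => //; first exact: (integrableZl measurableT (cnorm z) In).
by move=> x _; rewrite -cw -cnormM (le_trans (ler_norm _)) ?Re_le_cnorm.
Qed.

Section sections.
Variable F : R -> R -> R[i].
Hypothesis mF : cmeasurable_fun (fun z : R * R => F z.1 z.2).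
Hypothesis Ffin : (\int[mu]_x \int[mu]_y (cnorm (F x y))%:E < +oo)%E.

Lemma ae_cintegrable_section : {ae mu, forall x, cintegrable (F x)}.
Proof.
have mI : measurable_fun setT (fun x => \int[mu]_y (cnorm (F x y))%:E)%E by [].
have I0 x : (0 <= \int[mu]_y (cnorm (F x y))%:E)%E by [].
have II : mu.-integrable setT (fun x => \int[mu]_y (cnorm (F x y))%:E)%E.
  by apply/integrableP; split=> //; under eq_integral do rewrite gee0_abs//.
apply: lebesgue_aeS (integrable_ae measurableT II) => x /(_ I).
by rewrite ge0_fin_numE// => Fx_fin; split=> //; measurability.
Qed.

Lemma cintegrable_cintegral : cintegrable (fun x => cintegral setT (F x)).
Proof.
split; first by apply: cmeasurable_cintegral.
apply: le_lt_trans Ffin; apply: ge0_le_integral => //.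
by move=> x _; apply: le_cnorm_cintegral; measurability.
Qed.

Lemma cintegral_fubini : cintegral setT (fun x => cintegral setT (F x)) =
  cintegral setT (fun y => cintegral setT (fun x => F x y)).
Proof.
have [mRe mIm] := mF.
have fin_le (h : R * R -> R) : measurable_fun setT h ->
    (forall x y, `|h (x, y)| <= cnorm (F x y)) ->
    (\int[mu]_x \int[mu]_y `|(h (x, y))%:E| < +oo)%E.
  move=> mh hF; apply: le_lt_trans Ffin; apply: ge0_le_integral => //.
  by move=> x _; apply: ge0_le_integral => // y _; rewrite lee_fin.
have fin_Re := fin_le _ mRe (fun x y => Re_le_cnorm (F (x, y).1 (x, y).2)).
have fin_Im := fin_le _ mIm (fun x y => Im_le_cnorm (F (x, y).1 (x, y).2)).
apply/eqP; rewrite eq_complex; apply/andP; split; apply/eqP.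
- exact: (Rintegral_fubini mRe fin_Re).
- exact: (Rintegral_fubini mIm fin_Im).
Qed.

End sections.

End complex_integral.

(** * Averages of dilations *)

Section complex_Lnorm.
Variable R : realType.
Local Notation mu := (@lebesgue_measure R).
Implicit Types f g : R -> R[i].

Definition cLnorm (q : R) f : \bar R := Lnorm mu q%:E (fun x => (cnorm (f x))%:E).

Lemma cLnorm_ge0 q f : (0 <= cLnorm q f)%E.
Proof. exact: Lnorm_ge0. Qed.

Lemma ae_eq_cLnorm q f g : 0 < q -> cmeasurable_fun f -> cmeasurable_fun g ->
  {ae mu, forall x, f x = g x} -> cLnorm q f = cLnorm q g.
Proof.
move=> q0 mf mg fg; apply/eqP; rewrite eq_le; apply/andP; split; apply: ge0_ae_le_Lnorm => //.
- by apply: lebesgue_aeS fg => x ->.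
- by apply: lebesgue_aeS fg => x ->.
Qed.

Lemma cLnormD q f g : 1 <= q -> cmeasurable_fun f -> cmeasurable_fun g ->
  (cLnorm q (fun x => f x + g x)%R <= cLnorm q f + cLnorm q g)%E.
Proof.
move=> q1 mf mg.
have mnf : measurable_fun setT (fun x => cnorm (f x)) by [].
have mng : measurable_fun setT (fun x => cnorm (g x)) by [].
have q0 : 0 < q by exact: lt_le_trans q1.
apply: le_trans (minkowski_EFin mu mnf mng q1); apply: ge0_ae_le_Lnorm => //.
- by apply/measurable_EFinP; exact: measurable_funD.
- by move=> x; rewrite /= lee_fin addr_ge0 ?cnorm_ge0.
- by apply: aeW => x; rewrite /= lee_fin cnormD.
Qed.

Lemma ge0_Lnorm_dilate (q a : R) (f : R -> \bar R) : 0 < q -> a != 0 ->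
  measurable_fun setT f -> (forall x, 0 <= f x)%E ->
  (Lnorm mu q%:E (fun t => f (t * a)%R) = (`|a| `^ (- q^-1))%:E * Lnorm mu q%:E f)%E.
Proof.
move=> q0 a0 mf f0; rewrite !ge0_LnormE//.
rewrite (@ge0_integral_dilate R a (fun t => f t `^ q)%E)//.
rewrite poweRM ?integral_ge0 ?lee_fin ?invr_ge0// poweR_EFin.
by rewrite -(powR_inv1 (normr_ge0 a)) -powRrM mulN1r.
Qed.

Lemma cLnorm_dilate (q a : R) f : 0 < q -> a != 0 -> cmeasurable_fun f ->
  (cLnorm q (fun t => f (t * a)%R) = (`|a| `^ (- q^-1))%:E * cLnorm q f)%E.
Proof. by move=> q0 a0 mf; rewrite -ge0_Lnorm_dilate. Qed.

End complex_Lnorm.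

Section hausdorff.
Variable R : realType.
Local Notation mu := (@lebesgue_measure R).
Implicit Types (V th : R -> R) (f g : R -> R[i]).

Definition hausdorff V th f (x : R) : R[i] := cintegral setT (fun u => (V u)%:C * f (x * th u)).

Definition abs_hausdorff V th f (x : R) : \bar R :=
  (\int[mu]_u (V u * cnorm (f (x * th u)))%:E)%E.

Definition dilation_mass V th (q : R) : \bar R := (\int[mu]_u (V u * `|th u| `^ (- q^-1))%:E)%E.

Lemma le_dilation_mass V V' th q : measurable_fun setT V -> measurable_fun setT V' ->
  measurable_fun setT th -> (forall u, 0 <= V' u <= V u) ->
  (dilation_mass V' th q <= dilation_mass V th q)%E.
Proof.
move=> mV mV' mth V'V; have V'0 u : 0 <= V' u by case/andP: (V'V u).
have V0 u : 0 <= V u by case/andP: (V'V u); exact: le_trans.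
apply: ge0_le_integral => // u _; rewrite lee_fin ler_wpM2r//.
by case/andP: (V'V u).
Qed.

Section dilation_averages.
Variables (V th : R -> R).
Hypotheses (mV : measurable_fun setT V) (mth : measurable_fun setT th).
Hypotheses (V0 : forall u, 0 <= V u) (th0 : forall u, V u != 0 -> th u != 0).

Lemma dilation_mass_ge0 q : (0 <= dilation_mass V th q)%E.
Proof. exact: integral_ge0. Qed.

Lemma cmeasurable_hausdorff f : cmeasurable_fun f -> cmeasurable_fun (hausdorff V th f).
Proof. by move=> mf; rewrite /hausdorff; measurability. Qed.

Lemma measurable_abs_hausdorff f : cmeasurable_fun f -> measurable_fun setT (abs_hausdorff V th f).
Proof. by move=> mf; rewrite /abs_hausdorff; measurability. Qed.

Lemma abs_hausdorff_ge0 f x : (0 <= abs_hausdorff V th f x)%E.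
Proof. exact: integral_ge0. Qed.

Lemma abs_hausdorff_lty f x : cmeasurable_fun f -> (abs_hausdorff V th f x < +oo)%E ->
  cintegrable (fun u => (V u)%:C * f (x * th u)).
Proof.
move=> mf fin; apply: (@cintegrable_le _ _ (fun u => V u * cnorm (f (x * th u)))) => // u.
by rewrite cnorm_ge0_realM.
Qed.

Lemma Lnorm_dilation_average_le (q : R) (D : R -> R -> R[i]) (M : \bar R) : 1 <= q ->
  cmeasurable_fun (fun z : R * R => D z.1 z.2) -> (0 <= M)%E ->
  (forall u, V u != 0%R -> cLnorm q (D u) <= M)%E -> (dilation_mass V th q < +oo)%E ->
  (Lnorm mu q%:E (fun t => \int[mu]_u (V u * cnorm (D u (t * th u)))%:E) <=
   dilation_mass V th q * M)%E.
Proof.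
move=> q1 mD M0 DM massfin; have q0 : 0 < q by exact: lt_le_trans q1.
apply: (@minkowski_integral_le _ _ (measurableTypeR R) (measurableTypeR R) R mu mu q V
  (fun u => `|th u| `^ (- q^-1)) (fun z => cnorm (D z.1 (z.2 * th z.1))) M) => //.
- by move=> u /th0 thu; rewrite powR_gt0// normr_gt0.
- move=> u Vu; have mDu : cmeasurable_fun (D u) by measurability.
  rewrite -[X in (X <= _)%E]/(cLnorm q (fun t => D u (t * th u))) cLnorm_dilate ?th0//.
  by rewrite lee_wpmul2l ?DM.
Qed.

Lemma cLnorm_dilation_average_le (q : R) (D : R -> R -> R[i]) (M : \bar R) : 1 <= q ->
  cmeasurable_fun (fun z : R * R => D z.1 z.2) -> (0 <= M)%E ->
  (forall u, V u != 0%R -> cLnorm q (D u) <= M)%E -> (dilation_mass V th q < +oo)%E ->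
  (cLnorm q (fun t => cintegral setT (fun u => (V u)%:C * D u (t * th u))%R) <=
   dilation_mass V th q * M)%E.
Proof.
move=> q1 mD M0 DM massfin; apply: le_trans (Lnorm_dilation_average_le q1 mD M0 DM massfin).
apply: ge0_ae_le_Lnorm => //; first exact: lt_le_trans q1.
apply: aeW => t; apply: le_trans (le_cnorm_cintegral _) _; first by measurability.
by under eq_integral do rewrite cnorm_ge0_realM//.
Qed.

Lemma Lnorm_abs_hausdorff_le (q : R) f : 1 <= q -> cmeasurable_fun f ->
  (dilation_mass V th q < +oo)%E ->
  (Lnorm mu q%:E (abs_hausdorff V th f) <= dilation_mass V th q * cLnorm q f)%E.
Proof.
move=> q1 mf massfin.
by apply: (@Lnorm_dilation_average_le q (fun _ => f)) => //; exact: cLnorm_ge0.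
Qed.

Lemma cLnorm_hausdorff_le (q : R) f : 1 <= q -> cmeasurable_fun f ->
  (dilation_mass V th q < +oo)%E ->
  (cLnorm q (hausdorff V th f) <= dilation_mass V th q * cLnorm q f)%E.
Proof.
move=> q1 mf massfin.
by apply: (@cLnorm_dilation_average_le q (fun _ => f)) => //; exact: cLnorm_ge0.
Qed.

Lemma dilation_massM_lty (q : R) (M : \bar R) : (0 <= M)%E -> (M < +oo)%E ->
  (dilation_mass V th q < +oo)%E -> (dilation_mass V th q * M < +oo)%E.
Proof. by move=> M0 Mfin massfin; rewrite lte_mul_pinfty ?ge0_fin_numE ?dilation_mass_ge0. Qed.

Lemma Lnorm_abs_hausdorff_lty (q : R) f : 1 <= q -> in_Lp q f -> (dilation_mass V th q < +oo)%E ->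
  (Lnorm mu q%:E (abs_hausdorff V th f) < +oo)%E.
Proof.
move=> q1 [mf fq] massfin; apply: le_lt_trans (Lnorm_abs_hausdorff_le q1 mf massfin) _.
exact: dilation_massM_lty (cLnorm_ge0 _ _) fq massfin.
Qed.

Lemma in_Lp_hausdorff (q : R) f : 1 <= q -> in_Lp q f -> (dilation_mass V th q < +oo)%E ->
  in_Lp q (hausdorff V th f).
Proof.
move=> q1 [mf fq] massfin; split; first exact: cmeasurable_hausdorff.
apply: le_lt_trans (cLnorm_hausdorff_le q1 mf massfin) _.
exact: dilation_massM_lty (cLnorm_ge0 _ _) fq massfin.
Qed.

Lemma ae_abs_hausdorff_lty (q : R) f : 1 <= q -> in_Lp q f -> (dilation_mass V th q < +oo)%E ->
  {ae mu, forall x, (abs_hausdorff V th f x < +oo)%E}.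
Proof.
move=> q1 fq massfin; have q0 : 0 < q by exact: lt_le_trans q1.
have mA := measurable_abs_hausdorff fq.1.
have IA : mu.-integrable setT (fun x => abs_hausdorff V th f x `^ q)%E.
  apply/integrableP; split; first by measurability.
  under eq_integral do rewrite gee0_abs//.
  rewrite -ge0_poweR_Lnorm ?gt_eqF//; last exact: abs_hausdorff_ge0.
  exact/poweR_lty/Lnorm_abs_hausdorff_lty.
apply: lebesgue_aeS (integrable_ae measurableT IA) => x /(_ I).
by rewrite fin_numElt => /andP[_]; apply: lty_poweRy; exact: lt0r_neq0.
Qed.

End dilation_averages.

Lemma hausdorffD V V1 V2 th f (x : R) : measurable_fun setT V1 -> measurable_fun setT V2 ->
  measurable_fun setT th -> (forall u, 0 <= V1 u) -> (forall u, 0 <= V2 u) ->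
  (forall u, V u = V1 u + V2 u) -> cmeasurable_fun f -> (abs_hausdorff V th f x < +oo)%E ->
  hausdorff V th f x = hausdorff V1 th f x + hausdorff V2 th f x.
Proof.
move=> mV1 mV2 mth V10 V20 VE mf fin.
have mV : measurable_fun setT V by rewrite (_ : V = fun u => V1 u + V2 u)//; exact/funext.
have part_lty V' : measurable_fun setT V' -> (forall u, 0 <= V' u) -> (forall u, V' u <= V u) ->
    cintegrable (fun u => (V' u)%:C * f (x * th u)).
  move=> mV' V'0 V'V; apply: abs_hausdorff_lty => //; apply: le_lt_trans fin.
  by apply: ge0_le_integral => // u _; rewrite lee_fin ler_wpM2r.
rewrite /hausdorff -cintegralD.
- by apply: eq_cintegral => u; rewrite VE rmorphD/= mulrDl.
- by apply: part_lty => // u; rewrite VE lerDl.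
- by apply: part_lty => // u; rewrite VE lerDr.
Qed.

End hausdorff.

(** * The Fourier transform of an average of dilations *)

Section fourier_cut.
Variable R : realType.
Local Notation mu := (@lebesgue_measure R).
Implicit Types (f g : R -> R[i]) (chi : R -> R).

Definition cutoff (r x : R) : R := if `|x| <= r then 1 else 0.

Lemma cutoff_ge0 r x : 0 <= cutoff r x.
Proof. by rewrite /cutoff; case: ifP. Qed.

Lemma measurable_cutoff r : measurable_fun setT (cutoff r).
Proof. by rewrite /cutoff; measurability. Qed.

Lemma cutoff_scale (r c x : R) : 0 < c -> cutoff (r * c) x = cutoff r (x / c).
Proof. by move=> c0; rewrite /cutoff normrM normfV (gtr0_norm c0) ler_pdivrMr. Qed.

Definition fourier_cut chi f (t : R) : R[i] :=
  cintegral setT (fun x => (chi x)%:C * (expi (- (x * t)) * f x)).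

Lemma fourier_truncE f r : fourier_trunc f r = fourier_cut (cutoff r) f.
Proof.
apply/funext => t; rewrite /fourier_trunc cintegral_mkcond; apply: eq_cintegral => x.
congr (_%:C * _); rewrite indicE /cutoff ler_norml.
by case: ifPn => h; [rewrite mem_set|rewrite memNset//; apply/negP].
Qed.

Lemma fourier_L1E f : fourier_L1 f = fourier_cut (cst 1) f.
Proof. by apply/funext => t; apply: eq_cintegral => x; rewrite mul1r. Qed.

Lemma cmeasurable_fourier_trunc f r : cmeasurable_fun f -> cmeasurable_fun (fourier_trunc f r).
Proof. by move=> mf; rewrite fourier_truncE /fourier_cut /cutoff; measurability. Qed.

Lemma cmeasurable_fourier_trunc2 f (rho : R -> R) : measurable_fun setT rho -> cmeasurable_fun f ->
  cmeasurable_fun (fun z : R * R => fourier_trunc f (rho z.1) z.2).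
Proof.
move=> mrho mf; under eq_fun do rewrite fourier_truncE.
by rewrite /fourier_cut /cutoff; measurability.
Qed.

Lemma ae_eq_fourier_cut chi f g : measurable_fun setT chi -> cmeasurable_fun f ->
  cmeasurable_fun g -> {ae mu, forall x, f x = g x} -> fourier_cut chi f = fourier_cut chi g.
Proof.
move=> mchi mf mg fg; apply/funext => t.
by apply: ae_eq_cintegral; [measurability..|apply: lebesgue_aeS fg => x ->].
Qed.

Lemma integral_cutoff_lty r : (\int[mu]_x (cutoff r x)%:E < +oo)%E.
Proof.
have -> : (\int[mu]_x (cutoff r x)%:E = \int[mu]_x (\1_`[- r, r] x)%:E)%E.
  apply: eq_integral => x _; congr EFin; rewrite indicE /cutoff ler_norml.
  by rewrite mem_setE in_itv/=; case: ifP.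
rewrite integral_indic// setIT [ltLHS](_ : _ = mu `[- r, r]%classic)//.
by rewrite lebesgue_measure_itv/=; case: ifPn => _; rewrite -?EFinB ltry.
Qed.

Lemma integral_cutoffM_lty (q r : R) (A : R -> \bar R) : 1 <= q -> measurable_fun setT A ->
  (forall x, 0 <= A x)%E -> (Lnorm mu q%:E A < +oo)%E ->
  (\int[mu]_x ((cutoff r x)%:E * A x) < +oo)%E.
Proof.
move=> q1 mA A0 Aq; have q0 : 0 < q by exact: lt_le_trans q1.
have mr := measurable_cutoff r; have r0 x := cutoff_ge0 r x.
apply: (@le_lt_trans _ _ (\int[mu]_x ((cutoff r x)%:E + A x `^ q))%E).
  apply: ge0_le_integral => // x _; rewrite /cutoff; case: ifPn => _; last by rewrite mul0e add0e.
  rewrite mul1e; have := A0 x; case: (A x) => [y||]//; last by rewrite poweRyr ?gt_eqF// addey.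
  rewrite poweR_EFin -EFinD !lee_fin => y0.
  have [y1|y1] := leP y 1; first by rewrite (le_trans y1)// lerDl.
  by rewrite (@le_trans _ _ (y `^ q)) ?lerDr// le1r_powR// ltW.
rewrite ge0_integralD//= lte_add_pinfty ?integral_cutoff_lty//.
by rewrite -ge0_poweR_Lnorm ?gt_eqF// poweR_lty.
Qed.

End fourier_cut.

Section fourier_predicate.
Variable R : realType.
Local Notation mu := (@lebesgue_measure R).
Implicit Types f g : R -> R[i].

Lemma conj_exp_gt1 (p : R) : 1 < p -> 1 < conj_exp p.
Proof. by move=> p1; rewrite /conj_exp ltr_pdivlMr ?subr_gt0// mul1r ltrBlDr ltrDl. Qed.

Lemma invr_conj_exp (p : R) : 1 < p -> (conj_exp p)^-1 = 1 - p^-1.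
Proof.
by move=> p1; rewrite /conj_exp; field; rewrite subr_eq0 !gt_eqF// (lt_trans ltr01).
Qed.

Lemma addrV_conj_exp (p : R) : 1 < p -> p^-1 + (conj_exp p)^-1 = 1.
Proof. by move=> p1; rewrite invr_conj_exp// addrC subrK. Qed.

Lemma exists_gt0_mule_le (m : \bar R) (e : R) : (0 <= m)%E -> (m < +oo)%E -> 0 < e ->
  exists2 d, 0 < d & (m * d%:E <= e%:E)%E.
Proof.
move=> m0 mfin e0; have m10 : 0 < fine m + 1 by rewrite ltr_wpDl// fine_ge0.
exists (e / (fine m + 1)); first exact: divr_gt0.
rewrite -(fineK (_ : m \is a fin_num)) ?ge0_fin_numE// -EFinM lee_fin.
by rewrite mulrCA ger_pMr// ler_pdivrMr// mul1r lerDl.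
Qed.

Lemma ge0_cvg0_pinftyP (h : R -> \bar R) : (forall r, 0 <= h r)%E ->
  (h @ +oo --> 0%E) <->
  (forall e, 0 < e -> exists2 r0, 0 < r0 & forall r, r0 <= r -> (h r <= e%:E)%E).
Proof.
move=> h0; split=> [hcvg e e0|hle A nA].
- have e0E : (0 < e%:E :> \bar R)%E by rewrite lte_fin.
  have : nbhs (0 : \bar R)%E [set y | (y < e%:E)%E].
    by apply: open_nbhs_nbhs; split => //; exact: open_ereal_lt_ereal.
  move=> /hcvg [M [_ hM]]; exists (Num.max 1 (M + 1)); first by rewrite lt_max ltr01.
  move=> r; rewrite ge_max => /andP[_ rM].
  by apply/ltW/hM; apply: lt_le_trans rM; rewrite ltrDl.
- have [d /= d0 dA] : nbhs (0 : R) (fun y : R => A y%:E) by exact: nA.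
  have [r0 _ hr] := hle _ (divr_gt0 d0 (ltr0n _ 2)).
  exists r0; split; first exact: num_real.
  move=> r /ltW /hr /=; have := h0 r; case: (h r) => [y||]//; rewrite !lee_fin => y0 yd.
  apply: dA; rewrite /ball/= sub0r normrN ger0_norm//.
  by apply: le_lt_trans yd _; rewrite ltr_pdivrMr// mulr2n mulrDr mulr1 ltrDl.
Qed.

Lemma is_fourierP (p : R) f g : 1 < p ->
  is_fourier p f g <-> [/\ in_Lp p f, in_Lp (conj_exp p) g &
    forall e, 0 < e -> exists2 r0, 0 < r0 & forall r, r0 <= r ->
      (cLnorm (conj_exp p) (fun t => fourier_trunc f r t - g t)%R <= e%:E)%E].
Proof.
move=> p1; rewrite /is_fourier gt_eqF//.
have cvgP := ge0_cvg0_pinftyP (fun r =>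
  cLnorm_ge0 (conj_exp p) (fun t => fourier_trunc f r t - g t)).
by split=> [[fp [gq /cvgP]]|[fp gq /cvgP]].
Qed.

Lemma in_Lp_ae (p : R) f f' : 0 < p -> cmeasurable_fun f' ->
  {ae mu, forall x, f x = f' x} -> in_Lp p f -> in_Lp p f'.
Proof.
move=> p0 mf' ff' [mf fp]; split=> //.
by rewrite -[X in (X < _)%E]/(cLnorm p f') -(ae_eq_cLnorm p0 mf mf' ff').
Qed.

Lemma is_fourier_ae (p : R) f f' g : 1 < p -> cmeasurable_fun f' ->
  {ae mu, forall x, f x = f' x} -> is_fourier p f g -> is_fourier p f' g.
Proof.
move=> p1 mf' ff' /(is_fourierP _ _ p1)[fp gq cvg]; apply/(is_fourierP _ _ p1); split=> //.
  by apply: in_Lp_ae ff' fp => //; exact: lt_trans p1.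
move=> e /cvg[r0 r00 hr]; exists r0 => // r /hr.
by rewrite !fourier_truncE (ae_eq_fourier_cut (measurable_cutoff r) fp.1 mf' ff').
Qed.

End fourier_predicate.

Section fourier_hausdorff.
Variable R : realType.
Local Notation mu := (@lebesgue_measure R).
Implicit Types (V th chi : R -> R) (f g : R -> R[i]).

Definition hausdorff_dual V th : (R -> R[i]) -> R -> R[i] :=
  hausdorff (fun u => V u / th u) (fun u => (th u)^-1).

Section fixed_weight.
Variables (V th : R -> R).
Hypotheses (mV : measurable_fun setT V) (mth : measurable_fun setT th).
Hypotheses (V0 : forall u, 0 <= V u) (th_gt0 : forall u, V u != 0 -> 0 < th u).

Let Vth0 u : 0 <= V u / th u.
Proof. by have [->|/th_gt0/ltW thu] := eqVneq (V u) 0; rewrite ?mul0r ?divr_ge0. Qed.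

Let th_neq0 u : V u != 0 -> th u != 0.
Proof. by move=> /th_gt0 thu; rewrite gt_eqF. Qed.

Lemma dual_dilation_neq0 u : V u / th u != 0 -> (th u)^-1 != 0.
Proof. by rewrite mulf_eq0 => /norP[]. Qed.

Lemma dilation_mass_dual (p q : R) : p^-1 + q^-1 = 1 ->
  dilation_mass (fun u => V u / th u) (fun u => (th u)^-1) q = dilation_mass V th p.
Proof.
move=> pq; apply: eq_integral => u _; congr EFin.
have [->|/th_gt0 thu] := eqVneq (V u) 0; first by rewrite !mul0r.
rewrite normfV (gtr0_norm thu) -mulrA -(powR_inv1 (ltW thu)) -powRrM.
rewrite -powRD ?(gt_eqF thu) ?implybT//.
by rewrite (_ : -1 + -1 * - q^-1 = - p^-1)//; lra.
Qed.

Section dual_average.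
Variables (p : R) (g : R -> R[i]).
Local Notation q := (conj_exp p).
Hypotheses (p1 : 1 < p) (gq : in_Lp q g) (massfin : (dilation_mass V th p < +oo)%E).

Let mVth : measurable_fun setT (fun u => V u / th u). Proof. by []. Qed.
Let mthi : measurable_fun setT (fun u => (th u)^-1). Proof. by []. Qed.
Let q1 : 1 <= q. Proof. exact/ltW/conj_exp_gt1. Qed.
Let massE := dilation_mass_dual (addrV_conj_exp p1).
Let dual_massfin : (dilation_mass (fun u => V u / th u)%R (fun u => (th u)^-1)%R q < +oo)%E.
Proof. by rewrite massE. Qed.

Lemma in_Lp_hausdorff_dual : in_Lp q (hausdorff_dual V th g).
Proof. exact: (in_Lp_hausdorff mVth mthi Vth0 dual_dilation_neq0 q1 gq dual_massfin). Qed.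

Lemma cLnorm_hausdorff_dual_le :
  (cLnorm q (hausdorff_dual V th g) <= dilation_mass V th p * cLnorm q g)%E.
Proof.
rewrite -massE.
exact: (cLnorm_hausdorff_le mVth mthi Vth0 dual_dilation_neq0 q1 gq.1 dual_massfin).
Qed.

Lemma ae_abs_hausdorff_dual_lty : {ae mu, forall t,
  (abs_hausdorff (fun u => V u / th u)%R (fun u => (th u)^-1)%R g t < +oo)%E}.
Proof. exact: (ae_abs_hausdorff_lty mVth mthi Vth0 dual_dilation_neq0 q1 gq dual_massfin). Qed.

End dual_average.

Section fixed_function.
Variables (chi : R -> R) (f : R -> R[i]) (t : R).
Hypotheses (mchi : measurable_fun setT chi) (chi0 : forall x, 0 <= chi x).
Hypotheses (mf : cmeasurable_fun f).
Hypothesis fin : (\int[mu]_x ((chi x)%:E * abs_hausdorff V th f x) < +oo)%E.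

Let F x u : R[i] := (chi x)%:C * expi (- (x * t)) * ((V u)%:C * f (x * th u)).
Let G u y : R[i] := (V u / th u)%:C * ((chi (y / th u))%:C * (expi (- (y * (t / th u))) * f y)).

Let mF : cmeasurable_fun (fun z : R * R => F z.1 z.2).
Proof. by rewrite /F; measurability. Qed.

Let mG : cmeasurable_fun (fun z : R * R => G z.1 z.2).
Proof. by rewrite /G; measurability. Qed.

Let F_lty : (\int[mu]_x \int[mu]_u (cnorm (F x u))%:E < +oo)%E.
Proof.
rewrite (_ : (\int[mu]_x _)%E = \int[mu]_x ((chi x)%:E * abs_hausdorff V th f x))%E//.
apply: eq_integral => x _; rewrite /abs_hausdorff -ge0_integralZl_EFin//.
by apply: eq_integral => u _; rewrite /F -mulrA !cnorm_ge0_realM// cnormM cnorm_expi mul1r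
  cnorm_ge0_realM.
Qed.

Let F_dilate u : exists2 a, a != 0 & forall x, F x u = `|a|%:C * G u (x * a).
Proof.
have [Vu|Vu] := eqVneq (V u) 0.
  by exists 1 => [|x]; rewrite ?oner_eq0// /F /G Vu !(mul0r, rmorph0, mulr0).
exists (th u) => [|x]; first exact: th_neq0.
have thu := th_gt0 Vu; rewrite gtr0_norm// /F /G mulfK ?gt_eqF//.
rewrite (_ : x * th u * (t / th u) = x * t); last by field; rewrite gt_eqF.
by rewrite [RHS]mulrA -[in RHS]rmorphM/= (mulrC (th u)) divfK ?gt_eqF//; ring.
Qed.

Let cintegral_F u : cintegral setT (fun x => F x u) = cintegral setT (G u).
Proof.
have [a a0 FE] := F_dilate u; have mGu : cmeasurable_fun (G u) by measurability.
rewrite (eq_cintegral FE) cintegral_ge0Zl ?normr_ge0//.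
by rewrite cintegral_dilate// mulrA -rmorphM/= divff ?normr_eq0// mul1r.
Qed.

Let integral_F u : (\int[mu]_x (cnorm (F x u))%:E = \int[mu]_y (cnorm (G u y))%:E)%E.
Proof.
have [a a0 FE] := F_dilate u; have mGu : cmeasurable_fun (G u) by measurability.
under eq_integral do rewrite FE cnorm_ge0_realM// EFinM.
rewrite ge0_integralZl_EFin//.
rewrite (@ge0_integral_dilate R a (fun y => (cnorm (G u y))%:E))//.
by rewrite muleA -EFinM divff ?normr_eq0// mul1e.
Qed.

Let F_swap_lty : (\int[mu]_u \int[mu]_x (cnorm (F x u))%:E < +oo)%E.
Proof.
by rewrite -(@lebesgue_tonelli R (fun x u => (cnorm (F x u))%:E)).
Qed.

Let GE u : cintegral setT (G u) =
  (V u / th u)%:C * fourier_cut (fun y => chi (y / th u)) f (t / th u).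
Proof. by rewrite /G cintegral_ge0Zl//; measurability. Qed.

Lemma fourier_cut_hausdorff : fourier_cut chi (hausdorff V th f) t = cintegral setT (fun u =>
  (V u / th u)%:C * fourier_cut (fun y => chi (y / th u)) f (t / th u)).
Proof.
transitivity (cintegral setT (fun x => cintegral setT (F x))).
  apply: ae_eq_cintegral; [|by apply: cmeasurable_cintegral|].
    have mH := cmeasurable_hausdorff mV mth mf; measurability.
  apply: lebesgue_aeS (ae_cintegrable_section mF F_lty) => x Fx.
  by rewrite /F cintegralZl// ?mulrA//; measurability.
rewrite cintegral_fubini//; apply: eq_cintegral => u.
by rewrite cintegral_F GE.
Qed.

Lemma cintegrable_dilated_fourier_cut : cintegrable (fun u =>
  (V u / th u)%:C * fourier_cut (fun y => chi (y / th u)) f (t / th u)).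
Proof.
rewrite (_ : (fun u => _) = fun u => cintegral setT (fun x => F x u)); last first.
  by apply/funext => u; rewrite cintegral_F GE.
by apply: cintegrable_cintegral F_swap_lty; rewrite /F; measurability.
Qed.

Lemma fourier_cut_hausdorff_kernel : fourier_cut chi (hausdorff V th f) t = cintegral setT (fun y =>
  f y * cintegral setT (fun u => (V u / th u * chi (y / th u))%:C * expi (- (y * (t / th u))))).
Proof.
have G_lty : (\int[mu]_u \int[mu]_y (cnorm (G u y))%:E < +oo)%E.
  by under eq_integral do rewrite -integral_F.
have G_swap_lty : (\int[mu]_y \int[mu]_u (cnorm (G u y))%:E < +oo)%E.
  by rewrite -(@lebesgue_tonelli R (fun u y => (cnorm (G u y))%:E)).
have mG' : cmeasurable_fun (fun z : R * R => G z.2 z.1) by rewrite /G; measurability.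
rewrite fourier_cut_hausdorff (eq_cintegral (fun u => esym (GE u))) cintegral_fubini//.
apply: ae_eq_cintegral; [by apply: cmeasurable_cintegral|by measurability|].
apply: lebesgue_aeS (ae_cintegrable_section mG' G_swap_lty) => y Gy.
have GyE u : G u y =
    f y * ((V u / th u * chi (y / th u))%:C * expi (- (y * (t / th u)))).
  by rewrite /G rmorphM/=; ring.
rewrite (eq_cintegral GyE) cintegralZl//.
by rewrite (_ : (fun u => _) = G^~ y)//; apply/funext => u; rewrite GyE.
Qed.

End fixed_function.

End fixed_weight.

Section truncated_fourier_hausdorff.
Variables (V th : R -> R) (p : R) (f : R -> R[i]).
Hypotheses (mV : measurable_fun setT V) (mth : measurable_fun setT th).
Hypotheses (V0 : forall u, 0 <= V u) (th_gt0 : forall u, V u != 0 -> 0 < th u).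
Hypotheses (p1 : 1 <= p) (fp : in_Lp p f) (massfin : (dilation_mass V th p < +oo)%E).

Let th_neq0 u : V u != 0 -> th u != 0.
Proof. by move=> /th_gt0 thu; rewrite gt_eqF. Qed.

Lemma integral_cutoff_abs_hausdorff_lty r :
  (\int[mu]_x ((cutoff r x)%:E * abs_hausdorff V th f x) < +oo)%E.
Proof.
apply: (integral_cutoffM_lty _ p1) => [|x|].
- exact: (measurable_abs_hausdorff mV mth V0 fp.1).
- exact: abs_hausdorff_ge0.
- exact: Lnorm_abs_hausdorff_lty.
Qed.

Let fourier_cut_cutoff r t u : (V u / th u)%:C * fourier_trunc f (r * th u) t =
  (V u / th u)%:C * fourier_cut (fun y => cutoff r (y / th u)) f t.
Proof.
have [->|/th_gt0 thu] := eqVneq (V u) 0; first by rewrite !mul0r.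
congr (_ * _); rewrite fourier_truncE; apply: eq_cintegral => x.
by rewrite cutoff_scale.
Qed.

Lemma fourier_trunc_hausdorff r t : fourier_trunc (hausdorff V th f) r t =
  cintegral setT (fun u => (V u / th u)%:C * fourier_trunc f (r * th u) (t / th u)).
Proof.
under eq_cintegral do rewrite fourier_cut_cutoff.
rewrite fourier_truncE (fourier_cut_hausdorff mV mth V0 th_gt0 _ (measurable_cutoff r) _ fp.1)//.
- exact: cutoff_ge0.
- exact: integral_cutoff_abs_hausdorff_lty.
Qed.

Lemma cintegrable_fourier_trunc_dilate r t :
  cintegrable (fun u => (V u / th u)%:C * fourier_trunc f (r * th u) (t / th u)).
Proof.
rewrite (_ : (fun u => _) = fun u => (V u / th u)%:C *
    fourier_cut (fun y => cutoff r (y / th u)) f (t / th u)); last exact/funext.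
apply: (cintegrable_dilated_fourier_cut mV mth V0 th_gt0 _ (measurable_cutoff r) _ fp.1).
- exact: cutoff_ge0.
- exact: integral_cutoff_abs_hausdorff_lty.
Qed.

Lemma fourier_trunc_hausdorff_kernel r t : fourier_trunc (hausdorff V th f) r t =
  cintegral setT (fun y => f y * cintegral setT (fun u =>
    (V u / th u * cutoff r (y / th u))%:C * expi (- (y * (t / th u))))).
Proof.
rewrite fourier_truncE.
rewrite (fourier_cut_hausdorff_kernel mV mth V0 th_gt0 _ (measurable_cutoff r) _ fp.1)//.
- exact: cutoff_ge0.
- exact: integral_cutoff_abs_hausdorff_lty.
Qed.

End truncated_fourier_hausdorff.

Lemma fourier_trunc_hausdorffD V V1 V2 th (p r t : R) f :
  measurable_fun setT V1 -> measurable_fun setT V2 -> measurable_fun setT th ->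
  (forall u, 0 <= V1 u) -> (forall u, 0 <= V2 u) -> (forall u, V u = V1 u + V2 u) ->
  (forall u, V u != 0 -> 0 < th u) -> 1 <= p -> in_Lp p f -> (dilation_mass V th p < +oo)%E ->
  fourier_trunc (hausdorff V th f) r t =
  fourier_trunc (hausdorff V1 th f) r t + fourier_trunc (hausdorff V2 th f) r t.
Proof.
move=> mV1 mV2 mth V10 V20 VE th_gt0 p1 fp massfin.
have mV : measurable_fun setT V by rewrite (_ : V = fun u => V1 u + V2 u)//; exact/funext.
have V0 u : 0 <= V u by rewrite VE addr_ge0.
have part V' : measurable_fun setT V' -> (forall u, 0 <= V' u) -> (forall u, V' u <= V u) ->
    [/\ forall u, V' u != 0 -> 0 < th u & (dilation_mass V' th p < +oo)%E].
  move=> mV' V'0 V'V; split=> [u V'u|].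
    by apply: th_gt0; rewrite gt_eqF// (lt_le_trans _ (V'V u))// lt_def V'u V'0.
  by apply: le_lt_trans massfin; apply: le_dilation_mass => // u; rewrite V'0 V'V.
have V1V u : V1 u <= V u by rewrite VE lerDl.
have V2V u : V2 u <= V u by rewrite VE lerDr.
have [th1 mass1] := part V1 mV1 V10 V1V; have [th2 mass2] := part V2 mV2 V20 V2V.
rewrite !(@fourier_trunc_hausdorff _ th p)// -cintegralD.
- by apply: eq_cintegral => u; rewrite VE mulrDl rmorphD/= mulrDl.
- exact: (cintegrable_fourier_trunc_dilate mV1 mth V10 th1 p1 fp mass1).
- exact: (cintegrable_fourier_trunc_dilate mV2 mth V20 th2 p1 fp mass2).
Qed.

Section lower_bounded_dilations.
Variables (V th : R -> R) (p c : R).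
Hypotheses (mV : measurable_fun setT V) (mth : measurable_fun setT th).
Hypotheses (V0 : forall u, 0 <= V u) (c0 : 0 < c) (th_ge : forall u, V u != 0 -> c <= th u).
Hypotheses (p1 : 1 < p) (massfin : (dilation_mass V th p < +oo)%E).
Local Notation q := (conj_exp p).

Let th_gt0 u : V u != 0 -> 0 < th u. Proof. by move=> /th_ge; exact: lt_le_trans. Qed.
Let th_neq0 u : V u != 0 -> th u != 0. Proof. by move=> /th_gt0 thu; rewrite gt_eqF. Qed.
Let Vth0 u : 0 <= V u / th u.
Proof. by have [->|/th_gt0/ltW thu] := eqVneq (V u) 0; rewrite ?mul0r ?divr_ge0. Qed.
Let dual_neq0 u : V u / th u != 0 -> (th u)^-1 != 0. Proof. exact: dual_dilation_neq0. Qed.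
Let massE : dilation_mass (fun u => V u / th u) (fun u => (th u)^-1) q = dilation_mass V th p.
Proof. by apply: dilation_mass_dual => //; exact: addrV_conj_exp. Qed.

Let mVth : measurable_fun setT (fun u => V u / th u). Proof. by []. Qed.
Let mthi : measurable_fun setT (fun u => (th u)^-1). Proof. by []. Qed.

Lemma ae_fourier_hausdorffBE (r : R) f g : in_Lp p f -> in_Lp q g ->
  {ae mu, forall t, fourier_trunc (hausdorff V th f) r t - hausdorff_dual V th g t =
    cintegral setT (fun u =>
      (V u / th u)%:C * (fourier_trunc f (r * th u) (t / th u) - g (t / th u)))}.
Proof.
move=> fp gq; have mg : cmeasurable_fun g := gq.1.
apply: lebesgue_aeS (ae_abs_hausdorff_dual_lty mV mth V0 th_gt0 p1 gq massfin) => t gt.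
rewrite (fourier_trunc_hausdorff mV mth V0 th_gt0 (ltW p1) fp massfin) -cintegralB.
- by apply: eq_cintegral => u; rewrite mulrBr.
- exact: (cintegrable_fourier_trunc_dilate mV mth V0 th_gt0 (ltW p1) fp massfin).
- exact: (abs_hausdorff_lty mVth mthi Vth0 mg gt).
Qed.

Lemma cLnorm_fourier_hausdorffB_le (r e : R) f g : in_Lp p f -> in_Lp q g -> 0 <= e ->
  (forall r', r * c <= r' -> (cLnorm q (fun t => fourier_trunc f r' t - g t)%R <= e%:E)%E) ->
  0 <= r ->
  (cLnorm q (fun t => fourier_trunc (hausdorff V th f) r t - hausdorff_dual V th g t)%R <=
   dilation_mass V th p * e%:E)%E.
Proof.
move=> fp gq e0 he r0; have q1 := conj_exp_gt1 p1.
have mf : cmeasurable_fun f := fp.1; have mg : cmeasurable_fun g := gq.1.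
have mrth : measurable_fun setT (fun u => r * th u) by [].
have mT := cmeasurable_fourier_trunc2 mrth mf.
have mD : cmeasurable_fun (fun z : R * R => fourier_trunc f (r * th z.1) z.2 - g z.2).
  by apply: cmeasurable_funB; [exact: mT|measurability].
rewrite -massE; apply: le_trans (@cLnorm_dilation_average_le _ _ _ mVth mthi Vth0 dual_neq0 q
  (fun u s => fourier_trunc f (r * th u) s - g s) e%:E (ltW q1) mD _ _ _); last 1 first.
- by rewrite massE.
- rewrite le_eqVlt; apply/predU1P; left.
  apply: ae_eq_cLnorm (ae_fourier_hausdorffBE r fp gq).
  + exact: lt_trans q1.
  + apply: cmeasurable_funB; last exact: cmeasurable_hausdorff.
    by apply: cmeasurable_fourier_trunc; exact: cmeasurable_hausdorff.
  + apply: cmeasurable_cintegral; apply: cmeasurable_funM; first by measurability.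
    have mtth : measurable_fun setT (fun z : R * R => z.1 / th z.2) by [].
    exact: (cmeasurable_fun_comp2 (D := fun u s => fourier_trunc f (r * th u) s - g s)
      mD measurable_snd mtth).
- by rewrite lee_fin.
- move=> u Vu; apply: he; apply: ler_wpM2l r0 _ _ _; apply: th_ge.
  by apply: contra_neq Vu => ->; rewrite mul0r.
Qed.

Lemma is_fourier_hausdorff f g : is_fourier p f g ->
  is_fourier p (hausdorff V th f) (hausdorff_dual V th g).
Proof.
move=> /(is_fourierP _ _ p1)[fp gq cvg]; apply/(is_fourierP _ _ p1); split.
- exact: (in_Lp_hausdorff mV mth V0 th_neq0 (ltW p1) fp massfin).
- exact: (in_Lp_hausdorff_dual mV mth V0 th_gt0 p1 gq massfin).
move=> e e0; have [d d0 md] := exists_gt0_mule_le (dilation_mass_ge0 _ V0 _) massfin e0.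
have [r0 r00 hr0] := cvg _ d0; exists (r0 / c) => [|r]; first exact: divr_gt0 r00 c0.
rewrite (ler_pdivrMr _ _ c0) => r0r.
apply: le_trans (@cLnorm_fourier_hausdorffB_le r d f g fp gq (ltW d0) _ _) md.
- by move=> r' /(le_trans r0r); exact: hr0.
- by rewrite -(pmulr_lge0 _ c0) (le_trans (ltW r00)).
Qed.

End lower_bounded_dilations.

End fourier_hausdorff.

(** * Cesàro operators as averages of dilations *)

Lemma hausdorff_dualK (R : realType) (V th : R -> R) : (forall u, V u != 0 -> th u != 0) ->
  hausdorff_dual (fun u => V u / th u) (fun u => (th u)^-1) = hausdorff V th.
Proof.
move=> th0; rewrite /hausdorff_dual.
have -> : (fun u => V u / th u / (th u)^-1) = V.
  apply/funext => u; have [->|/th0 thu] := eqVneq (V u) 0; first by rewrite !mul0r.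
  by rewrite invrK divfK.
by under [X in hausdorff _ X]eq_fun do rewrite invrK.
Qed.

Section cesaro_operators.
Variables (R : realType) (beta : R).
Hypothesis beta0 : 0 < beta.
Local Notation mu := (@lebesgue_measure R).
Implicit Types (f g : R -> R[i]).

Definition cesaro_weight (u : R) : R := if 0 < u < 1 then beta * (1 - u) `^ (beta - 1) else 0.

Local Notation W := cesaro_weight.

Lemma cesaro_weight_ge0 u : 0 <= W u.
Proof. by rewrite /W; case: ifPn => // _; rewrite mulr_ge0// ltW. Qed.

Lemma cesaro_weight_supp u : W u != 0 -> 0 < u < 1.
Proof. by rewrite /W; case: ifPn; rewrite ?eqxx. Qed.

Lemma measurable_cesaro_weight : measurable_fun setT W.
Proof. by rewrite /W; measurability. Qed.

Let mW := measurable_cesaro_weight.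

Lemma integral_cesaro_weight_powR_lty (a : R) : -1 < a ->
  (\int[mu]_u (W u * `|u| `^ a)%:E < +oo)%E.
Proof.
move=> a1; rewrite (_ : (\int[mu]_u _)%E = \int[mu]_u
   (beta%:E * (if (0 < u < 1)%R then u `^ a * (1 - u) `^ (beta - 1) else 0)%:E))%E.
  rewrite ge0_integralZl_EFin ?(ltW beta0)//.
  rewrite lte_mul_pinfty ?lee_fin ?(ltW beta0)//; apply: integral_beta_lty => //.
  by rewrite ltrBrDr addNr.
apply: eq_integral => u _; rewrite /W -EFinM; congr EFin.
by case: ifPn => [/andP[u0 _]|_]; rewrite ?mul0r ?mulr0// (gtr0_norm u0) -mulrA (mulrC (u `^ a)).
Qed.

Lemma dilation_mass_cesaro_lty (p : R) : 1 < p -> (dilation_mass W id p < +oo)%E.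
Proof.
move=> p1; apply: integral_cesaro_weight_powR_lty.
by rewrite ltrN2 invf_lt1// (lt_trans ltr01).
Qed.

Lemma dilation_mass_cesaro_dual_lty (p : R) : 0 < p ->
  (dilation_mass (fun u => W u / u)%R (fun u => u^-1)%R p < +oo)%E.
Proof.
move=> p0; rewrite (_ : dilation_mass _ _ p = \int[mu]_u (W u * `|u| `^ (p^-1 - 1))%:E)%E.
  by apply: integral_cesaro_weight_powR_lty; rewrite ltrBrDr addNr invr_gt0.
apply: eq_integral => u _; congr EFin.
have [->|/cesaro_weight_supp/andP[u0 _]] := eqVneq (W u) 0; first by rewrite !mul0r.
rewrite normfV (gtr0_norm u0) -mulrA -(powR_inv1 (ltW u0)) -powRrM mulrNN mul1r -powRD.
  by rewrite addrC.
by rewrite (gt_eqF u0) implybT.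
Qed.

Lemma CesE f : cmeasurable_fun f -> Ces beta f = hausdorff W id f.
Proof.
move=> mf; apply/funext => t; have mI : measurable [set r : R | 0 <= r <= 1].
  rewrite (_ : [set r | _] = `[0, 1]%classic); first exact: measurable_itv.
  by apply/seteqP; split => x /=; rewrite in_itv.
rewrite /Ces cintegral_mkcond -cintegral_ge0Zl ?(ltW beta0)//.
apply: ae_eq_cintegral => //.
apply: lebesgue_aeS2 (ae_neq (0 : R)) (ae_neq 1) => u u0 u1.
rewrite mulrA mulrA -!rmorphM; congr (_%:C * _).
rewrite /W indicE !lt_neqAle u1 [0 == u]eq_sym u0 /=.
by case: ifPn => u01; [rewrite mem_set ?mulr1|rewrite memNset ?mulr0 ?mul0r//=; apply/negP].
Qed.

Definition cesaro_dual_kernel (t s : R) : R :=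
  if 1 <= s / t then `|s - t| `^ (beta - 1) / `|s| `^ beta else 0.

Lemma Cesdual_kernelE f t : t != 0 ->
  Cesdual beta f t = beta%:C * cintegral setT (fun s => (cesaro_dual_kernel t s)%:C * f s).
Proof.
move=> t0; rewrite /Cesdual /cesaro_dual_kernel.
have [tn|tp|/eqP] := ltgtP t 0; last by rewrite (negbTE t0).
- rewrite cintegral_mkcond; congr (_ * _); apply: eq_cintegral => s.
  rewrite mulrA -rmorphM; congr (_%:C * _); rewrite ler_ndivlMr// mul1r indicE.
  case: ifPn => st; last by rewrite memNset ?mul0r//=; apply/negP.
  by rewrite mem_set// mul1r distrC (ger0_norm (_ : 0 <= t - s)) ?subr_ge0.
- rewrite cintegral_mkcond; congr (_ * _); apply: eq_cintegral => s.
  rewrite mulrA -rmorphM; congr (_%:C * _); rewrite ler_pdivlMr// mul1r indicE.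
  case: ifPn => ts; last by rewrite memNset ?mul0r//=; apply/negP.
  by rewrite mem_set// mul1r !ger0_norm ?subr_ge0// (le_trans (ltW tp)).
Qed.

Definition cesaro_dual_profile (x : R) : R :=
  if 1 <= x then (x - 1) `^ (beta - 1) * x `^ (1 - beta) else 0.

Lemma cesaro_dual_kernel_dilate (t x : R) : t != 0 ->
  `|t| * cesaro_dual_kernel t (x * t) = `|x|^-1 * cesaro_dual_profile x.
Proof.
move=> t0; rewrite /cesaro_dual_kernel /cesaro_dual_profile mulfK//.
case: ifPn => [x1|_]; last by rewrite !mulr0.
have x0 : 0 < x by exact: lt_le_trans x1.
have nt0 : 0 < `|t| by rewrite normr_gt0.
rewrite (_ : x * t - t = (x - 1) * t); last by ring.
rewrite !normrM (gtr0_norm x0) (ger0_norm (_ : 0 <= x - 1)) ?subr_ge0//.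
rewrite !powRM ?subr_ge0 ?(ltW x0)//.
have -> : `|t| `^ (beta - 1) = `|t| `^ beta / `|t|.
  by rewrite powRB ?powRr1// (gt_eqF nt0) implybT.
have -> : x `^ (1 - beta) = x / x `^ beta.
  by rewrite powRB ?powRr1 ?(ltW x0)// (gt_eqF x0) implybT.
have xb0 : x `^ beta != 0 by rewrite gt_eqF ?powR_gt0.
have tb0 : `|t| `^ beta != 0 by rewrite gt_eqF ?powR_gt0.
by field; rewrite xb0 tb0 !gt_eqF.
Qed.

Lemma cesaro_dual_profile_inv (u : R) : u != 1 ->
  `|u|^-1 * (beta * cesaro_dual_profile u^-1) = W u / u.
Proof.
move=> u1; rewrite /cesaro_dual_profile /W.
have [u0|u0] := leP u 0.
  by rewrite [1 <= _]leNgt (le_lt_trans _ ltr01) ?invr_le0//= !(mulr0, mul0r).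
rewrite invf_ge1// lt_neqAle u1 /= (gtr0_norm u0).
case: ifPn => ule1; last by rewrite !(mulr0, mul0r).
have -> : u^-1 - 1 = (1 - u) * u^-1 by field; rewrite gt_eqF.
rewrite powRM ?subr_ge0 ?invr_ge0 ?(ltW u0)//.
rewrite -[X in beta * X]mulrA -powRD; last by rewrite invr_eq0 (gt_eqF u0) implybT.
by rewrite (_ : beta - 1 + (1 - beta) = 0) ?powRr0 ?mulr1 1?mulrC//; ring.
Qed.

Lemma CesdualE f t : cmeasurable_fun f -> t != 0 -> Cesdual beta f t = hausdorff_dual W id f t.
Proof.
move=> mf t0; rewrite Cesdual_kernelE//.
have mk : measurable_fun setT (cesaro_dual_kernel t) by rewrite /cesaro_dual_kernel; measurability.
have mP : measurable_fun setT cesaro_dual_profile by rewrite /cesaro_dual_profile; measurability.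
pose h x := (beta * cesaro_dual_profile x)%:C * f (t * x).
have mh : cmeasurable_fun h by rewrite /h; measurability.
have haar : beta%:C * cintegral setT (fun s => (cesaro_dual_kernel t s)%:C * f s) =
    cintegral setT (fun x => (`|x|^-1)%:C * h x).
  transitivity ((beta * `|t|)%:C *
      cintegral setT (fun x => (cesaro_dual_kernel t (x * t))%:C * f (x * t))).
    rewrite (@cintegral_dilate _ t (fun s => (cesaro_dual_kernel t s)%:C * f s))//.
    by rewrite mulrA -rmorphM mulfK ?normr_eq0.
  rewrite -cintegral_ge0Zl ?mulr_ge0 ?(ltW beta0)//; apply: eq_cintegral => x.
  rewrite /h (mulrC t) !mulrA -!rmorphM; congr (_%:C * _).
  by rewrite -mulrA cesaro_dual_kernel_dilate// mulrCA mulrA.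
rewrite haar -(cintegral_haar_inv mh); apply: ae_eq_cintegral => //.
apply: lebesgue_aeS (ae_neq (1 : R)) => u u1.
by rewrite /h mulrA -rmorphM cesaro_dual_profile_inv.
Qed.

Lemma ae_CesdualE f : cmeasurable_fun f ->
  {ae mu, forall t, hausdorff_dual W id f t = Cesdual beta f t}.
Proof. by move=> mf; apply: lebesgue_aeS (ae_neq (0 : R)) => t t0; rewrite CesdualE. Qed.

Let mW' : measurable_fun setT (fun u => W u / u). Proof. by []. Qed.
Let W'0 u : 0 <= W u / u.
Proof.
have [->|/cesaro_weight_supp/andP[/ltW u0 _]] := eqVneq (W u) 0; first by rewrite mul0r.
by rewrite divr_ge0// cesaro_weight_ge0.
Qed.
Let W'_supp u : W u / u != 0 -> 0 < u < 1.
Proof. by rewrite mulf_eq0 => /norP[/cesaro_weight_supp]. Qed.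
Let W'_neq0 u : W u / u != 0 -> u^-1 != 0. Proof. by rewrite mulf_eq0 => /norP[]. Qed.

Lemma cmeasurable_Cesdual f : cmeasurable_fun f -> cmeasurable_fun (Cesdual beta f).
Proof.
move=> mf; have mH : cmeasurable_fun (hausdorff_dual W id f) by exact: cmeasurable_hausdorff.
rewrite (_ : Cesdual beta f = fun t => (if t == 0 then 0 else 1)%:C * hausdorff_dual W id f t).
  by measurability.
apply/funext => t; case: ifPn => [/eqP ->|t0]; last by rewrite mul1r CesdualE.
by rewrite mul0r /Cesdual ltxx.
Qed.

Lemma hausdorff_dual_cesaroK : hausdorff_dual (fun u => W u / u) (fun u => u^-1) = hausdorff W id.
Proof. by apply: hausdorff_dualK => u /cesaro_weight_supp/andP[u0 _]; rewrite gt_eqF. Qed.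

Lemma is_fourier_Cesdual_gt1 (p : R) f g : 1 < p -> is_fourier p f g ->
  is_fourier p (Cesdual beta f) (Ces beta g).
Proof.
move=> p1 fg; have p0 : 0 < p by exact: lt_trans p1.
have [fp gq _] := (is_fourierP _ _ p1).1 fg.
have W'_ge1 u : W u / u != 0 -> 1 <= u^-1.
  by move=> /W'_supp/andP[u0 u1]; rewrite invf_ge1// ltW.
have := is_fourier_hausdorff mW' (@measurable_invr R) W'0 ltr01 W'_ge1 p1
  (dilation_mass_cesaro_dual_lty p0) fg.
rewrite hausdorff_dual_cesaroK -(CesE gq.1); apply: is_fourier_ae => //.
- exact: cmeasurable_Cesdual fp.1.
- exact: ae_CesdualE fp.1.
Qed.

Lemma is_fourier_Cesdual1 f g : is_fourier 1 f g -> is_fourier 1 (Cesdual beta f) (Ces beta g).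
Proof.
move=> [f1]; rewrite eqxx => gE; have mf : cmeasurable_fun f := f1.1.
have mC := cmeasurable_Cesdual mf; have massfin := dilation_mass_cesaro_dual_lty (@ltr01 R).
have mH : cmeasurable_fun (hausdorff_dual W id f) by exact: cmeasurable_hausdorff.
have gcut : g = fourier_cut (cst 1) f by apply/funext => t; rewrite gE fourier_L1E.
split.
  apply: in_Lp_ae (ae_CesdualE mf) _ => //.
  exact: (in_Lp_hausdorff mW' (@measurable_invr R) W'0 W'_neq0 (lexx 1) f1 massfin).
rewrite eqxx => t; rewrite fourier_L1E -(ae_eq_fourier_cut _ mH mC (ae_CesdualE mf))//.
have W'_gt0 u : W u / u != 0 -> 0 < u^-1 by move=> /W'_supp/andP[u0 _]; rewrite invr_gt0.
rewrite (fourier_cut_hausdorff mW' (@measurable_invr R) W'0 W'_gt0)//; last first.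
  under eq_integral do rewrite mul1e.
  have := Lnorm_abs_hausdorff_lty mW' (@measurable_invr R) W'0 W'_neq0 (lexx 1) f1 massfin.
  rewrite Lnorm1; under eq_integral do rewrite gee0_abs ?abs_hausdorff_ge0//.
  by [].
rewrite CesE; last by rewrite gcut /fourier_cut; measurability.
by rewrite -hausdorff_dual_cesaroK gcut.
Qed.

Lemma is_fourier_Cesdual (p : R) f g : 1 <= p -> is_fourier p f g ->
  is_fourier p (Cesdual beta f) (Ces beta g).
Proof.
rewrite le_eqVlt => /predU1P[<-|]; [exact: is_fourier_Cesdual1|exact: is_fourier_Cesdual_gt1].
Qed.

End cesaro_operators.

(** * Dilation kernels mapping L^p to L^p' *)

Section kernel_transform.
Variable R : realType.
Local Notation mu := (@lebesgue_measure R).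
Implicit Types (e : R -> R) (f : R -> R[i]).

Definition kernel_transform e f (t : R) : \bar R := (\int[mu]_y (cnorm (f y) * e (y * t))%:E)%E.

Section fixed_kernel.
Variables (e : R -> R) (p : R) (f : R -> R[i]).
Hypotheses (me : measurable_fun setT e) (e0 : forall x, 0 <= e x).
Hypotheses (p1 : 1 < p) (p2 : p <= 2) (fp : in_Lp p f).
Local Notation q := (conj_exp p).
Local Notation T := (kernel_transform e f).
Local Notation S := (abs_hausdorff e id f).

Let mf : cmeasurable_fun f := fp.1.
Let p_gt0 : 0 < p. Proof. exact: lt_trans p1. Qed.
Let q1 : 1 < q. Proof. exact: conj_exp_gt1. Qed.
Let q_gt0 : 0 < q. Proof. exact: lt_trans q1. Qed.
Let S_ge0 s : (0 <= S s)%E. Proof. exact: abs_hausdorff_ge0. Qed.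
Let mS : measurable_fun setT S. Proof. exact: (measurable_abs_hausdorff me _ e0 mf). Qed.

Lemma kernel_transform_ge0 t : (0 <= T t)%E.
Proof. by rewrite /kernel_transform; positivity. Qed.

Lemma measurable_kernel_transform : measurable_fun setT T.
Proof. by rewrite /kernel_transform; measurability. Qed.

Lemma kernel_transform_inv (s : R) : s != 0 -> T s^-1 = (`|s|%:E * S s)%E.
Proof.
move=> s0; rewrite (_ : S s = \int[mu]_u (cnorm (f (u * s)%R) * e (u * s / s)%R)%:E)%E.
  rewrite (@ge0_integral_dilate R s (fun y : R => (cnorm (f y) * e (y / s))%:E))//.
  by rewrite muleA -EFinM divff ?normr_eq0// mul1e.
by apply: eq_integral => u _; rewrite mulfK// mulrC (mulrC u).
Qed.

Lemma abs_hausdorff_id_le (s : R) : s != 0 ->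
  (S s <= (`|s| `^ (- p^-1))%:E * (cLnorm p f * Lnorm mu q%:E (EFin \o e)))%E.
Proof.
move=> s0; have mfs : measurable_fun setT (fun u : R => cnorm (f (u * s))) by [].
have := hoelder mu mfs me p_gt0 q_gt0 (addrV_conj_exp p1); rewrite Lnorm1.
rewrite (_ : Lnorm mu p%:E _ = cLnorm p (fun u : R => f (u * s)))//.
rewrite cLnorm_dilate// muleA; apply: le_trans; rewrite le_eqVlt; apply/predU1P; left.
by apply: eq_integral => u _; rewrite gee0_abs ?lee_fin ?mulr_ge0 ?cnorm_ge0// mulrC (mulrC s).
Qed.

(* The exponents match because (q - p) / p = q - 2 for conjugate exponents p and q. *)
Lemma powR_conj_exp_le (a x N : R) : 0 < a -> 0 <= x -> 0 <= N -> x <= a `^ (- p^-1) * N ->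
  a^-1 * (a^-1 * (a * x) `^ q) <= N `^ (q - p) * x `^ p.
Proof.
move=> a0; rewrite le_eqVlt => /predU1P[<- _ _|x0 N0 xN].
  by rewrite mulr0 !powR0 ?gt_eqF// !mulr0.
have qp : 0 <= q - p.
  by rewrite subr_ge0 /conj_exp ler_pdivlMr ?subr_gt0// ger_pMr// lerBlDr.
have -> : (a * x) `^ q = a `^ q * (x `^ (q - p) * x `^ p).
  by rewrite powRM ?(ltW a0) ?(ltW x0)// -powRD ?(gt_eqF x0) ?implybT// subrK.
have xqp : x `^ (q - p) <= a `^ (2 - q) * N `^ (q - p).
  have -> : 2 - q = - p^-1 * (q - p).
    by rewrite /conj_exp; field; rewrite !gt_eqF ?subr_gt0.
  by rewrite powRrM -powRM// ge0_ler_powR ?nnegrE ?mulr_ge0 ?(ltW x0).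
have aq : a^-1 * (a^-1 * (a `^ q * a `^ (2 - q))) = 1.
  rewrite -powRD ?(gt_eqF a0) ?implybT// addrC subrK (powR_mulrn 2 (ltW a0)).
  by field; rewrite gt_eqF.
have -> : N `^ (q - p) * x `^ p =
    a^-1 * (a^-1 * (a `^ q * ((a `^ (2 - q) * N `^ (q - p)) * x `^ p))).
  transitivity (a^-1 * (a^-1 * (a `^ q * a `^ (2 - q))) * (N `^ (q - p) * x `^ p)); last by ring.
  by rewrite aq mul1r.
by rewrite !ler_wpM2l ?invr_ge0 ?(ltW a0)// ler_wpM2r.
Qed.

Hypothesis e_supp : forall x, e x != 0 -> x != 0.
Hypothesis massfin : (dilation_mass e id p < +oo)%E.
Hypothesis normfin : (Lnorm mu q%:E (EFin \o e) < +oo)%E.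

Let N : R := fine (cLnorm p f * Lnorm mu q%:E (EFin \o e))%E.

Let N0 : 0 <= N. Proof. by rewrite fine_ge0// mule_ge0// cLnorm_ge0. Qed.

Let NE : (cLnorm p f * Lnorm mu q%:E (EFin \o e) = N%:E)%E.
Proof.
rewrite fineK// ge0_fin_numE ?mule_ge0 ?cLnorm_ge0//.
by rewrite lte_mul_pinfty ?cLnorm_ge0// ge0_fin_numE ?cLnorm_ge0//; exact: fp.2.
Qed.

Lemma kernel_transform_inv_powR_le (s : R) :
  ((`|s|^-1)%:E * (`|s^-1|%:E * T s^-1 `^ q) <= (N `^ (q - p))%:E * S s `^ p)%E.
Proof.
have [->|s0] := eqVneq s 0; first by rewrite normr0 invr0 mul0e; positivity.
have as0 : 0 < `|s| by rewrite normr_gt0.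
have := abs_hausdorff_id_le s0; rewrite NE kernel_transform_inv// normfV.
case: (S s) (S_ge0 s) => [x|_|//]; last by rewrite leye_eq.
by rewrite -!EFinM !lee_fin => x0 xN; exact: powR_conj_exp_le.
Qed.

Lemma Lnorm_kernel_transform_lty : (Lnorm mu q%:E T < +oo)%E.
Proof.
have T0 := kernel_transform_ge0; have mT := measurable_kernel_transform.
have mTq : measurable_fun setT (fun t : R => `|t|%:E * T t `^ q)%E by measurability.
have Tq0 t : (0 <= `|t|%:E * T t `^ q)%E by positivity.
rewrite ge0_LnormE//; apply: poweR_lty.
apply: (@le_lt_trans _ _ (haar_integral (fun t : R => `|t|%:E * T t `^ q)%E)).
  apply: ae_ge0_le_integral => //.
  apply: lebesgue_aeS (ae_neq (0 : R)) => t t0 _.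
  by rewrite muleA -EFinM mulVf ?normr_eq0// mul1e.
rewrite -(ge0_haar_integral_inv mTq Tq0).
apply: (@le_lt_trans _ _ (\int[mu]_s ((N `^ (q - p))%:E * S s `^ p))%E).
  by apply: ge0_le_integral => //= s _; exact: kernel_transform_inv_powR_le.
rewrite ge0_integralZl//.
rewrite -ge0_poweR_Lnorm ?gt_eqF// lte_mul_pinfty ?lee_fin ?poweR_lty//.
exact: (Lnorm_abs_hausdorff_lty me (@measurable_id _ _ setT) e0 e_supp (ltW p1) fp massfin).
Qed.

End fixed_kernel.

End kernel_transform.

(** * Oscillatory integrals *)

Section segment_integrals.
Variables (R : realType) (a b : R).
Local Notation mu := (@lebesgue_measure R).

Lemma is_derive_itv (h dh : R -> R) : a < b ->
  (forall x, a <= x <= b -> is_derive x 1 h (dh x)) ->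
  derivable_oo_LRcontinuous h a b /\ {in `]a, b[, h^`()%classic =1 dh}.
Proof.
move=> ab hdh; split; first split.
- move=> x; rewrite in_itv/= => /andP[/ltW ax /ltW xb].
  by have [] := hdh x; rewrite ?ax ?xb.
- apply: cvg_at_right_filter; apply: (@is_derive_continuous _ _ _ (dh a)); apply: hdh.
  by rewrite lexx ltW.
- apply: cvg_at_left_filter; apply: (@is_derive_continuous _ _ _ (dh b)); apply: hdh.
  by rewrite lexx ltW.
- move=> x; rewrite in_itv/= => /andP[/ltW ax /ltW xb]; rewrite derive1E.
  by have := hdh x; rewrite ax xb => /(_ isT) [_ ->].
Qed.

Lemma continuous_within_itv (h : R -> R) :
  (forall x, a <= x <= b -> {for x, continuous h}) -> {within `[a, b], continuous h}.
Proof. by move=> ch; apply: continuous_in_subspaceT => x; rewrite inE/= in_itv/=; exact: ch. Qed.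

Lemma continuous_itv_integrable (h : R -> R) :
  (forall x, a <= x <= b -> {for x, continuous h}) -> mu.-integrable `[a, b] (EFin \o h).
Proof.
move=> ch; apply: continuous_compact_integrable; first exact: segment_compact.
exact: continuous_within_itv.
Qed.

Lemma le_normr_Rintegral_itv (h k : R -> R) :
  (forall x, a <= x <= b -> {for x, continuous h}) ->
  (forall x, a <= x <= b -> {for x, continuous k}) ->
  (forall x, a <= x <= b -> `|h x| <= k x) ->
  `|Rintegral mu `[a, b] h| <= Rintegral mu `[a, b] k.
Proof.
move=> /continuous_itv_integrable Ih /continuous_itv_integrable Ik hk.
apply: le_trans (le_normr_Rintegral _ Ih) _; first exact: measurable_itv.
by apply: le_Rintegral => //; first exact: integrable_norm.
Qed.

Lemma normr_Rintegral_itv_le (h : R -> R) (M : R) : a < b ->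
  (forall x, a <= x <= b -> {for x, continuous h}) ->
  (forall x, a <= x <= b -> `|h x| <= M) -> `|Rintegral mu `[a, b] h| <= M * (b - a).
Proof.
move=> ab ch hM; apply: le_trans (@le_normr_Rintegral_itv h (cst M) ch _ hM) _.
  by move=> x _; exact: cst_continuous.
rewrite Rintegral_cst//.
by rewrite -[X in fine X]/(mu `[a, b]%classic) lebesgue_measure_itv/= lte_fin ab -EFinD.
Qed.

Lemma normr_Rintegration_by_parts_le (F G f g : R -> R) (A B D : R) : a < b ->
  (forall x, a <= x <= b -> is_derive x 1 F (f x)) ->
  (forall x, a <= x <= b -> is_derive x 1 G (g x)) ->
  (forall x, a <= x <= b -> {for x, continuous f}) ->
  (forall x, a <= x <= b -> {for x, continuous g}) ->
  (forall x, a <= x <= b -> `|F x| <= A) -> (forall x, a <= x <= b -> `|f x| <= B) ->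
  (forall x, a <= x <= b -> `|G x| <= D) ->
  `|Rintegral mu `[a, b] (fun x => F x * g x)| <= (2 * A + B * (b - a)) * D.
Proof.
move=> ab dF dG cf cg FA fB GD.
have [dF' F'f] := is_derive_itv ab dF; have [dG' G'g] := is_derive_itv ab dG.
rewrite (Rintegration_by_parts ab (continuous_within_itv cf) dF' F'f
  (continuous_within_itv cg) dG' G'g).
have aab : a <= a <= b by rewrite lexx ltW.
have bab : a <= b <= b by rewrite lexx ltW.
have boundary x : a <= x <= b -> `|F x * G x| <= A * D.
  by move=> xab; rewrite normrM; apply: ler_pM => //; [exact: FA|exact: GD].
have interior : `|Rintegral mu `[a, b] (fun x => f x * G x)| <= B * D * (b - a).
  apply: normr_Rintegral_itv_le => // x xab.
  - apply: continuousM; [exact: cf|exact: is_derive_continuous (dG x xab)].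
  - by rewrite normrM; apply: ler_pM => //; [exact: fB|exact: GD].
apply: le_trans (ler_normB _ _) _; apply: le_trans (lerD (ler_normB _ _) interior) _.
apply: le_trans (lerD (lerD (boundary b bab) (boundary a aab)) (lexx _)) _.
by rewrite le_eqVlt; apply/predU1P; left; ring.
Qed.

Lemma Rintegral_powR_le (d : R) : 0 < d -> 0 < a -> a < b ->
  Rintegral mu `[a, b] (fun x => x `^ (d - 1)) <= d^-1 * b `^ d.
Proof.
move=> d0 a0 ab; pose F (x : R) := d^-1 * x `^ d.
have dF x : a <= x <= b -> is_derive x 1 F (x `^ (d - 1)).
  move=> /andP[ax _]; have d1 := is_derive_powR d (lt_le_trans a0 ax).
  by apply: is_derive_eq; rewrite /GRing.scale/= mulrA mulVf ?gt_eqF// mul1r.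
have cf x : a <= x <= b -> {for x, continuous (fun y : R => y `^ (d - 1))}.
  by move=> /andP[ax _]; apply: is_derive_continuous (is_derive_powR _ (lt_le_trans a0 ax)).
have [dF' F'f] := is_derive_itv ab dF.
rewrite /Rintegral (continuous_FTC2 ab (continuous_within_itv cf) dF' F'f) -EFinB/=.
by rewrite lerBlDr lerDl mulr_ge0// invr_ge0 ltW.
Qed.

End segment_integrals.

Section oscillatory_integrals.
Variable R : realType.
Local Notation mu := (@lebesgue_measure R).
Variables (S T w dw : R -> R) (c M M' : R).
Hypotheses (dS : forall x : R, is_derive x 1 S (T x)) (cT : continuous T).
Hypotheses (S1 : forall x, `|S x| <= 1) (T1 : forall x, `|T x| <= 1).
Hypothesis c1 : c <= 1.
Hypotheses (wdw : forall x : R, 0 < x <= c -> is_derive x 1 w (dw x))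
  (cdw : forall x, 0 < x <= c -> {for x, continuous dw}).
Hypotheses (wM : forall x, 0 < x <= c -> `|w x| <= M)
  (dwM' : forall x, 0 < x <= c -> `|dw x| <= M').

Definition oscillatory_kernel (z u : R) : R := T (z / u) * (w u / u).

Local Notation k := oscillatory_kernel.

Lemma is_derive_divr (z x : R) : x != 0 -> is_derive x 1 (fun y : R => z / y) (- z / x ^+ 2).
Proof.
move=> x0; have dV := @is_deriveV R id x 1 1 x0 (is_derive_id _ _).
apply: (@is_derive_eq _ _ _ _ _ _ _ _
  (@is_deriveM R _ (cst z) (fun y : R => y^-1) x 1 _ _ (is_derive_cst _ _ _) dV)).
by rewrite /GRing.scale/= mulr0 addr0 mulr1 mulrN mulNr.
Qed.

Lemma continuous_comp_divr (h : R -> R) (z x : R) : x != 0 -> continuous h ->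
  {for x, continuous (fun y : R => h (z / y))}.
Proof.
move=> x0 ch; apply: (@continuous_comp _ _ _ (fun y : R => z / y) h); last exact: ch.
exact: is_derive_continuous (is_derive_divr z x0).
Qed.

Lemma continuous_oscillatory_kernel (z x : R) : 0 < x <= c -> {for x, continuous (k z)}.
Proof.
move=> xc; have x0 : x != 0 by case/andP: xc => x0 _; rewrite gt_eqF.
apply: continuousM; first exact: continuous_comp_divr.
by apply: continuousM (is_derive_continuous (wdw xc)) _; exact: inv_continuous.
Qed.

Lemma oscillatory_integral_by_parts_le (a b z : R) : 0 < a -> a < b -> b <= c -> z != 0 ->
  `|Rintegral mu `[a, b] (k z)| <= (3 * M + M') * (b / `|z|).
Proof.
move=> a0 ab bc z0; have b0 : 0 < b by exact: lt_trans ab.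
have sub x : a <= x <= b -> 0 < x <= c.
  by move=> /andP[ax xb]; rewrite (lt_le_trans a0 ax) (le_trans xb).
have neq0 x : a <= x <= b -> x != 0 by move=> /sub/andP[x0 _]; rewrite gt_eqF.
pose F u := u * w u; pose f u := w u + u * dw u.
pose G u := - z^-1 * S (z / u); pose g u := T (z / u) * (u^-1 * u^-1).
have dF x : a <= x <= b -> is_derive x 1 F (f x).
  move=> /sub xc; have dw' := wdw xc.
  by apply: is_derive_eq; rewrite /GRing.scale/= /f mulr1 addrC.
have dG x : a <= x <= b -> is_derive x 1 G (g x).
  move=> xab; have x0 := neq0 x xab.
  have dSz := @is_derive1_comp R S (fun y : R => z / y) x _ _ (dS _) (is_derive_divr z x0).
  apply: (@is_derive_eq _ _ _ _ _ _ _ _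
    (@is_deriveM R _ (cst (- z^-1)) _ x 1 _ _ (is_derive_cst _ _ _) dSz)).
  by rewrite /GRing.scale/= /g mulr0 addr0; field; rewrite x0 z0.
have cf x : a <= x <= b -> {for x, continuous f}.
  move=> /sub xc; apply: continuousD; first exact: is_derive_continuous (wdw xc).
  by apply: continuousM (cdw xc); exact: is_derive_continuous (is_derive_id _ _).
have cg x : a <= x <= b -> {for x, continuous g}.
  move=> xab; have x0 := neq0 x xab; apply: continuousM; first exact: continuous_comp_divr.
  by apply: continuousM; exact: inv_continuous.
rewrite (_ : Rintegral mu `[a, b] (k z) = Rintegral mu `[a, b] (fun x => F x * g x)); last first.
  apply: eq_Rintegral => x; rewrite inE/= in_itv/= => /neq0 x0.
  by rewrite /oscillatory_kernel /F /g; field.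
have bbc : 0 < b <= c by rewrite b0.
have MM'0 : 0 <= M + M'.
  by apply: addr_ge0; [apply: le_trans (wM bbc)|apply: le_trans (dwM' bbc)].
apply: le_trans (@normr_Rintegration_by_parts_le _ a b F G f g (b * M) (M + M') `|z|^-1
  ab dF dG cf cg _ _ _) _ => [x xab|x xab|x xab|].
- have /andP[ax xb] := xab; rewrite normrM ler_pM ?wM ?sub// gtr0_norm//.
  exact: lt_le_trans ax.
- have /andP[x0 xc] := sub x xab; rewrite /f (le_trans (ler_normD _ _))// lerD ?wM ?sub//.
  by rewrite normrM -[leRHS]mul1r ler_pM ?dwM' ?sub// gtr0_norm// (le_trans xc).
- by rewrite /G normrM normrN normfV ler_piMr// invr_ge0.
rewrite [leRHS]mulrA ler_wpM2r ?invr_ge0//.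
rewrite (_ : (3 * M + M') * b = 2 * (b * M) + (M + M') * b); last by ring.
by rewrite lerD2l ler_wpM2l// lerBlDr lerDl ltW.
Qed.

Lemma oscillatory_integral_powR_le (d a b z : R) : 0 < d -> 0 < a -> a < b -> b <= c ->
  z != 0 -> `|z| <= a -> `|Rintegral mu `[a, b] (k z)| <= M / d * (`|z| / b) `^ (- d).
Proof.
move=> d0 a0 ab bc z0 za; have b0 : 0 < b by exact: lt_trans ab.
have nz0 : 0 < `|z| by rewrite normr_gt0.
have sub x : a <= x <= b -> 0 < x <= c.
  by move=> /andP[ax xb]; rewrite (lt_le_trans a0 ax) (le_trans xb).
have M0 : 0 <= M by apply: le_trans (wM (sub b _)); rewrite ?normr_ge0// lexx ltW.
pose h (u : R) : R := M * `|z| `^ (- d) * u `^ (d - 1).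
have cpow x : a <= x <= b -> {for x, continuous (fun u : R => u `^ (d - 1))}.
  by move=> /sub/andP[x0 _]; exact: is_derive_continuous (is_derive_powR _ x0).
apply: le_trans (@le_normr_Rintegral_itv _ a b (k z) h _ _ _) _ => [x xab|x xab|x xab|].
- exact: continuous_oscillatory_kernel (sub x xab).
- by apply: continuousM (cpow x xab); exact: cst_continuous.
- have /andP[x0 xc] := sub x xab; have /andP[ax _] := xab.
  rewrite normrM (le_trans (ler_piMl _ (T1 _)))// normrM /h -mulrA.
  apply: ler_pM => //; first exact: wM (sub x xab).
  rewrite gtr0_norm ?invr_gt0// powRB ?(gt_eqF x0) ?implybT// powRr1 ?(ltW x0)// mulrA.
  rewrite ler_peMl ?invr_ge0 ?(ltW x0)// powRN mulrC ler_pdivlMr ?powR_gt0// mul1r.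
  by rewrite ge0_ler_powR ?nnegrE ?(ltW d0) ?(ltW x0)// (le_trans za).
rewrite RintegralZl//; last exact: continuous_itv_integrable.
apply: le_trans (ler_wpM2l _ (Rintegral_powR_le d0 a0 ab)) _; first by rewrite mulr_ge0.
rewrite powRM ?invr_ge0 ?(ltW b0)// -(powR_inv1 (ltW b0)) -powRrM mulrNN mul1r.
by rewrite le_eqVlt; apply/predU1P; left; ring.
Qed.

Lemma oscillatory_integral_le (d a b z : R) : 0 < d -> 0 < a -> a <= b -> b <= c -> z != 0 ->
  `|Rintegral mu `[a, b] (k z)| <= (3 * M + M' + M / d) * broken_power (- d) (-1) (z / b).
Proof.
move=> d0 a0 ab bc z0; have nz0 : 0 < `|z| by rewrite normr_gt0.
have b0 : 0 < b by exact: lt_le_trans ab.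
have bbc : 0 < b <= c by rewrite b0.
have M0 : 0 <= M by apply: le_trans (wM bbc).
have M'0 : 0 <= M' by apply: le_trans (dwM' bbc).
have K0 : 0 <= 3 * M + M' by rewrite addr_ge0// mulr_ge0.
have Md0 : 0 <= M / d by rewrite divr_ge0// ltW.
have nzb : `|z / b| = `|z| / b by rewrite normrM normfV (gtr0_norm b0).
move: ab; rewrite le_eqVlt => /predU1P[<-|ab].
  by rewrite set_itv1 Rintegral_set1 normr0 mulr_ge0 ?broken_power_ge0// addr_ge0.
have [zb|zb] := leP b `|z|.
  have -> : broken_power (- d) (-1) (z / b) = b / `|z|.
    rewrite /broken_power nzb divr_gt0//= ltr_pdivrMr// mul1r ltNge zb/= ler_pdivlMr// mul1r zb.
    by rewrite powR_inv1 ?divr_ge0 ?(ltW b0)// invf_div.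
  apply: le_trans (oscillatory_integral_by_parts_le a0 ab bc z0) _.
  by rewrite ler_wpM2r ?divr_ge0 ?(ltW b0)// lerDl.
have -> : broken_power (- d) (-1) (z / b) = (`|z| / b) `^ (- d).
  by rewrite /broken_power nzb divr_gt0//= ltr_pdivrMr// mul1r zb.
have [za|az] := leP `|z| a.
  apply: le_trans (oscillatory_integral_powR_le d0 a0 ab bc z0 za) _.
  by rewrite ler_wpM2r// lerDr.
have ge1 : 1 <= (`|z| / b) `^ (- d).
  rewrite powRN invf_ge1 ?powR_gt0 ?divr_gt0// (_ : 1 = 1 `^ d); last by rewrite powR1.
  by rewrite ge0_ler_powR ?nnegrE ?(ltW d0) ?divr_ge0 ?(ltW b0)// ler_pdivrMr// mul1r ltW.
have integrable_k e : 0 < e -> mu.-integrable `[e, b] (EFin \o k z).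
  move=> e0; apply: continuous_itv_integrable => x /andP[ex xb].
  by apply: continuous_oscillatory_kernel; rewrite (lt_le_trans e0 ex) (le_trans xb).
have := @Rintegral_itvB R (k z) (BLeft a) (BRight b) `|z| (integrable_k a a0).
rewrite !bnd_simp => /(_ (ltW az) (ltW zb)) /eqP; rewrite subr_eq => /eqP ->.
rewrite Rintegral_itv_obnd_cbnd//; last first.
  by apply: integrableS (integrable_k _ nz0) => //=; apply: subset_itv; rewrite bnd_simp.
apply: le_trans (ler_normD _ _) _; rewrite addrC mulrDl; apply: lerD.
- apply: le_trans (oscillatory_integral_by_parts_le a0 az (le_trans (ltW zb) bc) z0) _.
  by rewrite divff ?gt_eqF// ler_wpM2l.
- exact: oscillatory_integral_powR_le.
Qed.

End oscillatory_integrals.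

(** * Cutting off the small dilations *)

Section fourier_approximation.
Variable R : realType.
Implicit Types f g h k : R -> R[i].

Lemma cLnormN (q : R) f : cLnorm q (fun x => - f x) = cLnorm q f.
Proof. by rewrite /cLnorm; under eq_fun do rewrite cnormN. Qed.

Lemma is_fourier_approx (p : R) h k : 1 < p -> in_Lp p h -> in_Lp (conj_exp p) k ->
  (forall e, 0 < e -> exists h1 k1, [/\ is_fourier p h1 k1,
     (forall r, 0 < r ->
       (cLnorm (conj_exp p) (fun t => fourier_trunc h r t - fourier_trunc h1 r t)%R <= e%:E)%E) &
     (cLnorm (conj_exp p) (fun t => k1 t - k t)%R <= e%:E)%E]) ->
  is_fourier p h k.
Proof.
move=> p1 hp kq approx; apply/(is_fourierP _ _ p1); split=> // e e0.
have e30 : 0 < e / 3 by exact: divr_gt0.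
have [h1 [k1 [/(is_fourierP _ _ p1)[h1p k1q cvg] h1h k1k]]] := approx _ e30.
have mh : cmeasurable_fun h := hp.1; have mk : cmeasurable_fun k := kq.1.
have mh1 : cmeasurable_fun h1 := h1p.1; have mk1 : cmeasurable_fun k1 := k1q.1.
have [r0 r00 h1r] := cvg _ e30; exists r0 => // r r0r.
have mFh := cmeasurable_fourier_trunc r mh; have mFh1 := cmeasurable_fourier_trunc r mh1.
have q1 := ltW (conj_exp_gt1 p1).
rewrite (_ : (fun t => _) = fun t => (fourier_trunc h r t - fourier_trunc h1 r t) +
    ((fourier_trunc h1 r t - k1 t) + (k1 t - k t))); last first.
  by apply/funext => t; rewrite !addrA !subrK.
rewrite (_ : e%:E = (e / 3)%:E + ((e / 3)%:E + (e / 3)%:E))%E; last first.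
  by rewrite -!EFinD; congr EFin; field.
apply: le_trans (cLnormD q1 (cmeasurable_funB mFh mFh1)
  (cmeasurable_funD (cmeasurable_funB mFh1 mk1) (cmeasurable_funB mk1 mk))) _.
apply: leeD; first exact: h1h (lt_le_trans r00 r0r).
apply: le_trans (cLnormD q1 (cmeasurable_funB mFh1 mk1) (cmeasurable_funB mk1 mk)) _.
by apply: leeD => //; exact: h1r.
Qed.

End fourier_approximation.

Section cut_weight.
Variables (R : realType) (V th : R -> R) (kap : R).

Definition cut_below (u : R) : R := if th u <= kap then V u else 0.
Definition cut_above (u : R) : R := if th u <= kap then 0 else V u.

Lemma cut_belowD u : V u = cut_below u + cut_above u.
Proof. by rewrite /cut_below /cut_above; case: ifP; rewrite ?addr0 ?add0r. Qed.

Hypotheses (mV : measurable_fun setT V) (mth : measurable_fun setT th).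

Lemma measurable_cut_below : measurable_fun setT cut_below.
Proof. by rewrite /cut_below; measurability. Qed.

Lemma measurable_cut_above : measurable_fun setT cut_above.
Proof. by rewrite /cut_above; measurability. Qed.

Hypothesis V0 : forall u, 0 <= V u.

Lemma cut_below_bounds u : 0 <= cut_below u <= V u.
Proof. by rewrite /cut_below; case: ifP; rewrite ?lexx V0. Qed.

Lemma cut_above_bounds u : 0 <= cut_above u <= V u.
Proof. by rewrite /cut_above; case: ifP; rewrite ?lexx V0. Qed.

Lemma cut_above_supp u : cut_above u != 0 -> kap <= th u.
Proof. by rewrite /cut_above; case: leP => [|/ltW]; rewrite ?eqxx. Qed.

End cut_weight.

Section small_dilations.
Variable R : realType.
Variables (V th : R -> R) (p : R) (f g : R -> R[i]).
Local Notation q := (conj_exp p).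
Hypotheses (mV : measurable_fun setT V) (mth : measurable_fun setT th).
Hypotheses (V0 : forall u, 0 <= V u) (th_gt0 : forall u, V u != 0 -> 0 < th u).
Hypotheses (p1 : 1 < p) (massfin : (dilation_mass V th p < +oo)%E) (fg : is_fourier p f g).

Let fp : in_Lp p f. Proof. by have [] := (is_fourierP _ _ p1).1 fg. Qed.
Let gq : in_Lp q g. Proof. by have [] := (is_fourierP _ _ p1).1 fg. Qed.
Let th_neq0 u : V u != 0 -> th u != 0. Proof. by move=> /th_gt0 thu; rewrite gt_eqF. Qed.
Let mthi : measurable_fun setT (fun u => (th u)^-1). Proof. by []. Qed.
Let div_ge0 (V' : R -> R) u : 0 <= V' u <= V u -> 0 <= V' u / th u.
Proof.
have [Vu|/th_gt0/ltW thu /andP[V'0 _]] := eqVneq (V u) 0; last exact: divr_ge0.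
by rewrite Vu => /le_anti <-; rewrite mul0r.
Qed.
Let q1 : 1 <= q. Proof. exact/ltW/conj_exp_gt1. Qed.

Section fixed_threshold.
Variable kap : R.
Local Notation B := (cut_below V th kap).
Local Notation A := (cut_above V th kap).

Let mB : measurable_fun setT B. Proof. exact: measurable_cut_below. Qed.
Let mA : measurable_fun setT A. Proof. exact: measurable_cut_above. Qed.
Let B0 u : 0 <= B u. Proof. by case/andP: (cut_below_bounds th kap V0 u). Qed.
Let A0 u : 0 <= A u. Proof. by case/andP: (cut_above_bounds th kap V0 u). Qed.

Lemma cut_below_gt0 u : B u != 0 -> 0 < th u.
Proof. by rewrite /cut_below; case: ifP => _; [exact: th_gt0|rewrite eqxx]. Qed.

Lemma dilation_mass_cut_below_lty : (dilation_mass B th p < +oo)%E.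
Proof.
exact: le_lt_trans (le_dilation_mass p mV mB mth (cut_below_bounds th kap V0)) massfin.
Qed.

Lemma is_fourier_cut_above : 0 < kap -> is_fourier p (hausdorff A th f) (hausdorff_dual A th g).
Proof.
move=> kap0; apply: (is_fourier_hausdorff mA mth A0 kap0 (@cut_above_supp _ V th kap) p1 _ fg).
exact: le_lt_trans (le_dilation_mass p mV mA mth (cut_above_bounds th kap V0)) massfin.
Qed.

Lemma fourier_trunc_cut_belowE r t : fourier_trunc (hausdorff V th f) r t -
  fourier_trunc (hausdorff A th f) r t = fourier_trunc (hausdorff B th f) r t.
Proof.
rewrite (fourier_trunc_hausdorffD r t mB mA mth B0 A0 (cut_belowD V th kap) th_gt0 (ltW p1)
  fp massfin).
by rewrite addrK.
Qed.

Lemma cLnorm_hausdorff_dual_cut_le : (cLnorm q (fun t => hausdorff_dual A th g t -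
  hausdorff_dual V th g t)%R <= dilation_mass B th p * cLnorm q g)%E.
Proof.
have mBth : measurable_fun setT (fun u => B u / th u) by [].
have mAth : measurable_fun setT (fun u => A u / th u) by [].
have Bth0 u : 0 <= B u / th u by exact/div_ge0/cut_below_bounds.
have Ath0 u : 0 <= A u / th u by exact/div_ge0/cut_above_bounds.
have mg : cmeasurable_fun g := gq.1.
have mH V' : measurable_fun setT V' -> cmeasurable_fun (hausdorff V' (fun u => (th u)^-1) g).
  by move=> mV'; exact: cmeasurable_hausdorff.
rewrite (@ae_eq_cLnorm _ _ _ (fun t => - hausdorff_dual B th g t)).
- rewrite cLnormN.
  exact: (cLnorm_hausdorff_dual_le mB mth B0 cut_below_gt0 p1 gq dilation_mass_cut_below_lty).
- exact: lt_le_trans q1.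
- by apply: cmeasurable_funB; exact: mH.
- have -> : (fun t => - hausdorff_dual B th g t) = fun t => 0%:C - hausdorff_dual B th g t.
    by apply/funext => t; rewrite sub0r.
  by apply: cmeasurable_funB; [exact: cmeasurable_fun_real|exact: mH].
apply: lebesgue_aeS (ae_abs_hausdorff_dual_lty mV mth V0 th_gt0 p1 gq massfin) => t gt.
have VE u : V u / th u = B u / th u + A u / th u by rewrite -mulrDl -cut_belowD.
rewrite /hausdorff_dual (hausdorffD mBth mAth mthi Bth0 Ath0 VE mg gt).
by rewrite opprD addrCA subrr addr0.
Qed.

End fixed_threshold.

Lemma is_fourier_hausdorff_cut :
  (forall e, 0 < e -> exists2 kap, 0 < kap & (dilation_mass (cut_below V th kap) th p <= e%:E)%E /\
    forall r, 0 < r ->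
      (cLnorm q (fourier_trunc (hausdorff (cut_below V th kap) th f) r) <= e%:E)%E) ->
  is_fourier p (hausdorff V th f) (hausdorff_dual V th g).
Proof.
move=> small; apply: (is_fourier_approx p1 _
  (in_Lp_hausdorff_dual mV mth V0 th_gt0 p1 gq massfin)) => [|e e0].
  exact: (in_Lp_hausdorff mV mth V0 th_neq0 (ltW p1) fp massfin).
have [d d0 gd] := exists_gt0_mule_le (cLnorm_ge0 q g) gq.2 e0.
have de0 : 0 < Num.min d e by rewrite lt_min d0.
have [kap kap0 [mass_d trunc_e]] := small _ de0.
exists (hausdorff (cut_above V th kap) th f), (hausdorff_dual (cut_above V th kap) th g); split.
- exact: is_fourier_cut_above.
- move=> r r0; under eq_fun do rewrite fourier_trunc_cut_belowE.
  by apply: le_trans (trunc_e r r0) _; rewrite lee_fin ge_min lexx orbT.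
apply: le_trans (cLnorm_hausdorff_dual_cut_le kap) _; apply: le_trans gd.
rewrite muleC lee_wpmul2l ?cLnorm_ge0//; apply: le_trans mass_d _.
by rewrite lee_fin ge_min lexx.
Qed.

End small_dilations.

(** * The Fourier transform of the Cesàro average *)

Section cesaro_small_dilations.
Variables (R : realType) (beta p : R) (f : R -> R[i]).
Local Notation mu := (@lebesgue_measure R).
Hypotheses (beta0 : 0 < beta) (p1 : 1 < p) (p2 : p <= 2) (fp : in_Lp p f).
Local Notation q := (conj_exp p).
Local Notation W := (cesaro_weight beta).
(* Any exponent in ]0, 1/q[ would do. *)
Local Notation d := ((2 * q)^-1).
Local Notation e := (broken_power (- d) (-1)).

Let q1 : 1 < q. Proof. exact: conj_exp_gt1. Qed.
Let q_gt0 : 0 < q. Proof. exact: lt_trans q1. Qed.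
Let d_gt0 : 0 < d. Proof. by rewrite invr_gt0 mulr_gt0. Qed.
Let dq : d * q = 2^-1. Proof. by field; rewrite gt_eqF. Qed.
Let d_lt : d < q^-1. Proof. by rewrite invfM gtr_pMl ?invr_gt0// invf_lt1 ?ltr1n. Qed.
Let pq : q^-1 = 1 - p^-1. Proof. exact: invr_conj_exp. Qed.
Let mW : measurable_fun setT W. Proof. exact: measurable_cesaro_weight. Qed.
Let W0 u : 0 <= W u. Proof. exact: cesaro_weight_ge0. Qed.
Let me : measurable_fun setT e. Proof. exact: measurable_broken_power. Qed.
Let e0 y : 0 <= e y. Proof. exact: broken_power_ge0. Qed.

Lemma kernel_transform_broken_power_lty : (Lnorm mu q%:E (kernel_transform e f) < +oo)%E.
Proof.
apply: (Lnorm_kernel_transform_lty me e0 p1 p2 fp).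
- by move=> x; apply: contra_neq => ->; exact: broken_power0.
- rewrite /dilation_mass; under eq_integral do rewrite broken_powerM.
  apply: integral_broken_power_lty.
  + by rewrite -opprD ltrN2 -ltrBrDr -pq.
  + by rewrite gtrDl oppr_lt0 invr_gt0 (lt_trans ltr01).
- rewrite ge0_LnormE//; apply: poweR_lty.
  rewrite (_ : (\int[mu]_x _)%E = \int[mu]_x (broken_power (- d * q) (-1 * q) x)%:E)%E.
    apply: integral_broken_power_lty; last by rewrite mulN1r ltrN2.
    by rewrite mulNr dq ltrN2 invf_lt1 ?ltr1n.
  by apply: eq_integral => x _; rewrite /= broken_power_powR ?gt_eqF.
Qed.

Definition cesaro_amplitude (u : R) : R := beta * (1 - u) `^ (beta - 1).
Definition cesaro_amplitude_deriv (u : R) : R := - (beta * (beta - 1)) * (1 - u) `^ (beta - 2).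
Definition cesaro_amplitude_bound : R := beta * (1 + 2^-1 `^ (beta - 1)).
Definition cesaro_amplitude_deriv_bound : R := beta * `|beta - 1| * (1 + 2^-1 `^ (beta - 2)).

Local Notation w := cesaro_amplitude.
Local Notation dw := cesaro_amplitude_deriv.
Local Notation M := cesaro_amplitude_bound.
Local Notation M' := cesaro_amplitude_deriv_bound.
Local Notation C := (3 * M + M' + M / d).

Let C0 : 0 <= C.
Proof. by have := ltW beta0; have := ltW d_gt0 => *; rewrite /M' /M; positivity. Qed.

Let w_derive (x : R) : 0 < x <= 2^-1 -> is_derive x 1 w (dw x).
Proof.
move=> /andP[_ x2]; have x1 : x < 1 by apply: le_lt_trans x2 _; rewrite invf_lt1 ?ltr1n.
apply: (@is_derive_eq _ _ _ _ _ _ _ _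
  (@is_deriveM R _ (cst beta) _ x 1 _ _ (is_derive_cst _ _ _) (is_derive_1B_powR (beta - 1) x1))).
rewrite /GRing.scale/= /dw mulr0 addr0 (_ : beta - 1 - 1 = beta - 2); last by ring.
by rewrite mulrN mulNr mulrA.
Qed.

Let dw_continuous (x : R) : 0 < x <= 2^-1 -> {for x, continuous dw}.
Proof.
move=> /andP[_ x2]; have x1 : x < 1 by apply: le_lt_trans x2 _; rewrite invf_lt1 ?ltr1n.
apply: continuousM; first exact: cst_continuous.
exact: is_derive_continuous (is_derive_1B_powR (beta - 2) x1).
Qed.

Let half_bound (c x : R) : 0 < x <= 2^-1 -> `|(1 - x) `^ c| <= 1 + 2^-1 `^ c.
Proof.
move=> /andP[x0 x2]; rewrite ger0_norm//; apply: powR_half_itv_le.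
by apply/andP; split; lra.
Qed.

Let w_le (x : R) : 0 < x <= 2^-1 -> `|w x| <= M.
Proof. by move=> /half_bound wx; rewrite normrM (gtr0_norm beta0) ler_wpM2l// ltW. Qed.

Let dw_le (x : R) : 0 < x <= 2^-1 -> `|dw x| <= M'.
Proof.
by move=> /half_bound wx; rewrite normrM normrN normrM (gtr0_norm beta0) ler_wpM2l// mulr_ge0// ltW.
Qed.

Section fixed_cut.
Variables (kap r : R).
Hypotheses (kap0 : 0 < kap) (kap2 : kap <= 2^-1) (r0 : 0 < r).
Local Notation B := (cut_below W id kap).

Let mB : measurable_fun setT B. Proof. exact: measurable_cut_below. Qed.
Let mr := measurable_cutoff r.
Let B0 u : 0 <= B u. Proof. by case/andP: (cut_below_bounds id kap W0 u). Qed.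
Let B_gt0 u : B u != 0 -> 0 < u.
Proof. by apply: cut_below_gt0 => v /cesaro_weight_supp/andP[]. Qed.

Lemma cut_kernel_oscillatoryE (T : R -> R) (y t u : R) : y != 0 ->
  B u / u * cutoff r (y / u) * T (- (y * (t / u))) =
  (oscillatory_kernel T w (- (y * t)) \_ `[`|y| / r, kap]) u.
Proof.
move=> y0; have ny : 0 < `|y| by rewrite normr_gt0.
rewrite patchE mem_setE in_itv/= /cut_below /cesaro_weight.
case: (leP u kap) => uk; last by rewrite andbF !mul0r.
have u1 : u < 1 by rewrite (le_lt_trans uk)// (le_lt_trans kap2)// invf_lt1// ltr1n.
rewrite andbT u1 andbT; case: (ltP 0 u) => u0; last first.
  by rewrite !mul0r ifF//; apply/negbTE; rewrite -ltNge (le_lt_trans u0)// divr_gt0.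
rewrite /cutoff normrM normfV (gtr0_norm u0) !ler_pdivrMr// (mulrC r).
case: ifPn => _; last by rewrite mulr0 mul0r.
by rewrite /oscillatory_kernel mulr1 [RHS]mulrC (_ : - (y * t) / u = - (y * (t / u)))// mulNr mulrA.
Qed.

Lemma normr_Rintegral_cut_kernel_le (S T : R -> R) (y t : R) :
  (forall x : R, is_derive x 1 S (T x)) -> continuous T ->
  (forall x, `|S x| <= 1) -> (forall x, `|T x| <= 1) -> y != 0 -> t != 0 ->
  `|Rintegral mu setT (fun u => B u / u * cutoff r (y / u) * T (- (y * (t / u))))|
  <= C * e (y * (t / kap)).
Proof.
move=> dS cT S1 T1 y0 t0; under eq_Rintegral do rewrite cut_kernel_oscillatoryE//.
rewrite -Rintegral_mkcond; have [yk|ky] := leP (`|y| / r) kap; last first.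
  by rewrite set_itv_ge ?Rintegral_set0 ?normr0 ?mulr_ge0// bnd_simp -ltNge.
have a0 : 0 < `|y| / r by rewrite divr_gt0// normr_gt0.
have z0 : - (y * t) != 0 by rewrite oppr_eq0 mulf_neq0.
have half1 : 2^-1 <= 1 :> R by rewrite invf_le1 ?ler1n.
apply: le_trans (oscillatory_integral_le dS cT S1 T1 half1 w_derive dw_continuous w_le dw_le
  d_gt0 a0 yk kap2 z0) _.
by rewrite (_ : - (y * t) / kap = - (y * (t / kap))) ?broken_powerN// mulNr mulrA.
Qed.

Definition cut_kernel (y t : R) : R[i] := cintegral setT (fun u =>
  (B u / u * cutoff r (y / u))%:C * expi (- (y * (t / u)))).

Lemma cnorm_cut_kernel_le (y t : R) : y != 0 -> t != 0 ->
  cnorm (cut_kernel y t) <= 2 * C * e (y * (t / kap)).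
Proof.
move=> y0 t0; apply: le_trans (cnorm_le_ReIm _) _.
rewrite -mulrA mulr_natl mulr2n /cut_kernel /cintegral; apply: lerD => /=.
- under eq_Rintegral do rewrite mul0r subr0.
  apply: (@normr_Rintegral_cut_kernel_le sin cos) => //.
  + exact: continuous_cos.
  + by move=> x; exact: sin_max.
  + by move=> x; exact: cos_max.
- under eq_Rintegral do rewrite mul0r addr0.
  apply: (@normr_Rintegral_cut_kernel_le (fun x => - cos x) sin) => //.
  + move=> x; have dN := @is_deriveN R _ _ cos x 1 _ (is_derive_cos x).
    apply: (@is_derive_eq _ _ _ _ _ _ _ _ dN).
    by rewrite opprK.
  + exact: continuous_sin.
  + by move=> x; rewrite normrN; exact: cos_max.
  + by move=> x; exact: sin_max.
Qed.

Lemma cnorm_fourier_trunc_cut_le (t : R) : t != 0 ->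
  ((cnorm (fourier_trunc (hausdorff B id f) r t))%:E <=
   (2 * C)%:E * kernel_transform e f (t / kap))%E.
Proof.
move=> t0; have mf : cmeasurable_fun f := fp.1.
have massfin := dilation_mass_cut_below_lty mW (@measurable_id _ _ setT) W0
  (dilation_mass_cesaro_lty beta0 p1) kap.
rewrite (fourier_trunc_hausdorff_kernel mB (@measurable_id _ _ setT) B0 B_gt0 (ltW p1) fp massfin).
have mk : cmeasurable_fun (fun y => cut_kernel y t) by rewrite /cut_kernel; measurability.
apply: le_trans (le_cnorm_cintegral (cmeasurable_funM mf mk)) _.
have C20 : 0 <= 2 * C by rewrite mulr_ge0.
have me' : measurable_fun setT (fun y : R => e (y * (t / kap))) by [].
rewrite /kernel_transform -ge0_integralZl_EFin//.
apply: ae_ge0_le_integral => //.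
  by move=> y _; rewrite mule_ge0// lee_fin ?mulr_ge0 ?cnorm_ge0.
apply: lebesgue_aeS (ae_neq (0 : R)) => y y0 _.
by rewrite -EFinM lee_fin cnormM mulrCA ler_wpM2l ?cnorm_ge0// cnorm_cut_kernel_le.
Qed.

Lemma cLnorm_fourier_trunc_cut_le : (cLnorm q (fourier_trunc (hausdorff B id f) r) <=
  (2 * C * kap `^ q^-1)%:E * Lnorm mu q%:E (kernel_transform e f))%E.
Proof.
have mf : cmeasurable_fun f := fp.1; have C20 : 0 <= 2 * C by rewrite mulr_ge0.
have mT := measurable_kernel_transform me e0 fp; have T0 := kernel_transform_ge0 f e0.
have kapV0 : kap^-1 != 0 by rewrite invr_eq0 gt_eqF.
have mH : cmeasurable_fun (hausdorff B id f).
  exact: (cmeasurable_hausdorff mB (@measurable_id _ _ setT) mf).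
rewrite (_ : kap `^ q^-1 = `|kap^-1| `^ (- q^-1)); last first.
  by rewrite normfV (gtr0_norm kap0) -(powR_inv1 (ltW kap0)) -powRrM mulrNN mul1r.
have mTkap : measurable_fun setT (fun t : R => kernel_transform e f (t / kap)).
  by apply: measurableT_comp mT _.
rewrite EFinM -muleA -(ge0_Lnorm_dilate q_gt0 kapV0 mT T0).
rewrite -(ge0_LnormZl mu q_gt0 C20 mTkap (fun t => T0 _)).
apply: ge0_ae_le_Lnorm => //.
- exact/measurable_EFinP/measurable_cnorm/cmeasurable_fourier_trunc.
- by move=> t; rewrite mule_ge0// lee_fin.
- by apply: lebesgue_aeS (ae_neq (0 : R)) => t; exact: cnorm_fourier_trunc_cut_le.
Qed.

Lemma dilation_mass_cut_le : (dilation_mass B id p <=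
  (kap `^ d)%:E * \int[mu]_u (W u * `|u| `^ (- p^-1 - d))%:E)%E.
Proof.
rewrite -ge0_integralZl_EFin//; apply: ge0_le_integral => //= u _.
rewrite -EFinM lee_fin /cut_below; case: ifPn => uk; last by rewrite mul0r; positivity.
have [->|Wu] := eqVneq (W u) 0; first by rewrite !mul0r mulr0.
have /andP[u0 _] := cesaro_weight_supp Wu.
rewrite mulrCA ler_wpM2l// gtr0_norm// powRB ?(gt_eqF u0) ?implybT// mulrCA ler_peMr//.
by rewrite ler_pdivlMr ?powR_gt0// mul1r ge0_ler_powR ?nnegrE ?(ltW u0) ?(ltW kap0) ?(ltW d_gt0).
Qed.

End fixed_cut.

Lemma cesaro_small_dilations (eps : R) : 0 < eps -> exists2 kap, 0 < kap &
  (dilation_mass (cut_below W id kap) id p <= eps%:E)%E /\ forall r, 0 < r ->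
    (cLnorm q (fourier_trunc (hausdorff (cut_below W id kap) id f) r) <= eps%:E)%E.
Proof.
move=> eps0; set I := (\int[mu]_u (W u * `|u| `^ (- p^-1 - d))%:E)%E.
set N := Lnorm mu q%:E (kernel_transform e f).
have I0 : (0 <= I)%E by rewrite /I; positivity.
have N0 : (0 <= (2 * C)%:E * N)%E by rewrite mule_ge0 ?Lnorm_ge0// lee_fin mulr_ge0.
have Ifin : (I < +oo)%E.
  by apply: integral_cesaro_weight_powR_lty => //; rewrite -opprD ltrN2 addrC -ltrBrDr -pq.
have Nfin : ((2 * C)%:E * N < +oo)%E.
  by rewrite lte_mul_pinfty ?lee_fin ?mulr_ge0// kernel_transform_broken_power_lty.
have [dl dl0 dl_eps] := exists_gt0_mule_le (adde_ge0 I0 N0) (lte_add_pinfty Ifin Nfin) eps0.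
pose kap := Num.min 2^-1 (dl `^ d^-1).
have kap0 : 0 < kap by rewrite lt_min invr_gt0 ltr0n powR_gt0.
have kap2 : kap <= 2^-1 by rewrite ge_min lexx.
have kapd : kap `^ d <= dl.
  rewrite [leRHS](_ : dl = (dl `^ d^-1) `^ d).
    by rewrite ge0_ler_powR ?nnegrE ?(ltW kap0) ?(ltW d_gt0)// ge_min lexx orbT.
  by rewrite -powRrM mulVf ?gt_eqF// powRr1 ?ltW.
have kapq : kap `^ q^-1 <= dl.
  apply: le_trans kapd; rewrite ger_powR// ?(ltW d_lt)// kap0 (le_trans kap2)//.
  by rewrite invf_le1 ?ler1n.
exists kap => //; split=> [|r r0].
- apply: le_trans (dilation_mass_cut_le kap0) _; apply: le_trans dl_eps.
  by rewrite muleC; apply: lee_pmul; rewrite ?lee_fin ?leeDl.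
apply: le_trans (cLnorm_fourier_trunc_cut_le kap0 kap2 r0) _; apply: le_trans dl_eps.
by rewrite EFinM muleAC; apply: lee_pmul; rewrite ?lee_fin ?leeDr.
Qed.

End cesaro_small_dilations.

Lemma is_fourier_Ces (R : realType) (beta p : R) (f g : R -> R[i]) : 0 < beta ->
  1 < p -> p <= 2 -> is_fourier p f g ->
  is_fourier p (Ces beta f) (hausdorff_dual (cesaro_weight beta) id g).
Proof.
move=> beta0 p1 p2 fg; have [fp _ _] := (is_fourierP _ _ p1).1 fg.
rewrite (CesE beta0 fp.1); apply: is_fourier_hausdorff_cut => //.
- exact: measurable_cesaro_weight.
- by move=> u; exact: cesaro_weight_ge0.
- by move=> u /cesaro_weight_supp/andP[].
- exact: dilation_mass_cesaro_lty.
- by move=> eps; exact: cesaro_small_dilations.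
Qed.

Theorem theorem6p4 (R : realType) (beta : R) (hbeta : 0 < beta) :
  (* (i) *)
  (forall (p : R) (f g : R -> R[i]),
      1 < p <= 2 -> in_Lp p f -> is_fourier p f g ->
      exists h : R -> R[i], is_fourier p (Ces beta f) h /\
        {ae @lebesgue_measure R, forall t, h t = Cesdual beta g t}) /\
  (* (ii) *)
  (forall (p : R) (f g : R -> R[i]),
      1 <= p <= 2 -> in_Lp p f -> is_fourier p f g ->
      exists h : R -> R[i], is_fourier p (Cesdual beta f) h /\
        {ae @lebesgue_measure R, forall t, h t = Ces beta g t}).
Proof.
split=> p f g /andP[p1 p2] fp fg.
- have [_ [mg _] _] := (is_fourierP _ _ p1).1 fg.
  exists (hausdorff_dual (cesaro_weight beta) id g); split; first exact: is_fourier_Ces.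
  exact: (ae_CesdualE hbeta mg).
- by exists (Ces beta g); split; [exact: is_fourier_Cesdual|exact: aeW].
Qed.
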